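(* Let $U,W$ be open neighborhoods of $[-q,q]$ in $\mathbb C$ and let $\mathcal F_n(\lambda_1,\dots,\lambda_n;z_1,\dots,z_n)$ be holomorphic on $U^n\times W^n$ and symmetric separately in the variables $\lambda_1,\dots,\lambda_n$ and in the variables $z_1,\dots,z_n$. Then for any compact sets $K\subset U$ and $P\subset W$ there exist sequences $(\varphi_p)_{p\in\mathbb N}$ and $(\phi_p)_{p\in\mathbb N}$ of functions holomorphic on a neighborhood of $K$, resp. of $P$, such that $$\mathcal F_n(\lambda_1,\dots,\lambda_n;z_1,\dots,z_n)=\sum_{p=0}^{\infty}\prod_{i=1}^n\varphi_p(\lambda_i)\phi_p(z_i)$$ uniformly on $K^n\times P^n$. *)

(* Defs.v *)
From Stdlib Require Import Reals List.
From mathcomp Require Import all_boot.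
Set Implicit Arguments. Unset Strict Implicit. Unset Printing Implicit Defensive.

Open Scope R_scope.

Definition Cx : Type := (R * R)%type.
Definition RtoC (x : R) : Cx := (x, 0).
Definition C0 : Cx := (0, 0).
Definition C1 : Cx := (1, 0).
Definition Cadd (z w : Cx) : Cx := (fst z + fst w, snd z + snd w).
Definition Copp (z : Cx) : Cx := (- fst z, - snd z).
Definition Csub (z w : Cx) : Cx := Cadd z (Copp w).
Definition Cmul (z w : Cx) : Cx :=
  (fst z * fst w - snd z * snd w, fst z * snd w + snd z * fst w).
Definition Cnorm (z : Cx) : R := sqrt (fst z ^ 2 + snd z ^ 2).

Definition Copen (U : Cx -> Prop) : Prop :=
  forall z, U z -> exists r, 0 < r /\ forall w, Cnorm (Csub w z) < r -> U w.

Definition Ccompact (K : Cx -> Prop) : Prop :=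
  forall (I : Type) (O : I -> Cx -> Prop),
    (forall i, Copen (O i)) ->
    (forall z, K z -> exists i, O i z) ->
    exists l : list I, forall z, K z -> exists i, In i l /\ O i z.

Definition open_nbhd_segment (q : R) (U : Cx -> Prop) : Prop :=
  Copen U /\ forall x, - q <= x <= q -> U (RtoC x).

Definition Cdifferentiable_at (f : Cx -> Cx) (z : Cx) : Prop :=
  exists a : Cx, forall eps, 0 < eps -> exists delta, 0 < delta /\
    forall w, Cnorm (Csub w z) < delta ->
      Cnorm (Csub (Csub (f w) (f z)) (Cmul a (Csub w z)))
        <= eps * Cnorm (Csub w z).

Definition holomorphic_on (V : Cx -> Prop) (f : Cx -> Cx) : Prop :=
  forall z, V z -> Cdifferentiable_at f z.

Definition Csum n (F : 'I_n -> Cx) : Cx := \big[Cadd/C0]_(i < n) F i.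
Definition Cprod n (F : 'I_n -> Cx) : Cx := \big[Cmul/C1]_(i < n) F i.
Definition Rsum n (F : 'I_n -> R) : R := \big[Rplus/0]_(i < n) F i.

Definition holomorphic_on_prod n (U W : Cx -> Prop)
    (F : ('I_n -> Cx) -> ('I_n -> Cx) -> Cx) : Prop :=
  forall (l z : 'I_n -> Cx), (forall i, U (l i)) -> (forall i, W (z i)) ->
  exists a b : 'I_n -> Cx, forall eps, 0 < eps -> exists delta, 0 < delta /\
    forall l' z' : 'I_n -> Cx,
      (forall i, Cnorm (Csub (l' i) (l i)) < delta /\
                 Cnorm (Csub (z' i) (z i)) < delta) ->
      Cnorm (Csub (Csub (F l' z') (F l z))
                  (Cadd (Csum (fun i => Cmul (a i) (Csub (l' i) (l i))))
                        (Csum (fun i => Cmul (b i) (Csub (z' i) (z i))))))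
        <= eps * Rsum (fun i => Cnorm (Csub (l' i) (l i))
                                + Cnorm (Csub (z' i) (z i))).

Definition separately_symmetric n (F : ('I_n -> Cx) -> ('I_n -> Cx) -> Cx) : Prop :=
  forall (s : 'I_n -> 'I_n), bijective s ->
    forall l z, F (fun i => l (s i)) z = F l z /\ F l (fun i => z (s i)) = F l z.

Definition partial_sum n (phi psi : nat -> Cx -> Cx) (M : nat)
    (l z : 'I_n -> Cx) : Cx :=
  \big[Cadd/C0]_(p < M) Cprod (fun i => Cmul (phi p (l i)) (psi p (z i))).

(* Main.v *)
From HB Require Import structures.
Require Import Defs.
From Stdlib Require Import Reals List Lra Psatz.
From mathcomp Require Import all_boot all_fingroup all_algebra boolp.
From Stdlib Require Import ClassicalEpsilon.
From Coquelicot Require Import Coquelicot.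
Set Implicit Arguments. Unset Strict Implicit. Unset Printing Implicit Defensive.
Import GRing.Theory.
(* Stdlib's [R_scope] claims the key [%R] as well. *)
Delimit Scope ring_scope with R.
Open Scope R_scope.

(** Freeze the variables one at a time.  For a function of one variable [l] in a compact
    set and of further parameters [x], Cauchy's formula on small squares shows that it is,
    uniformly in [x], within an error exponentially small in [r] of a function of rank [r].
    Choosing sample points that nearly maximize an [r]-minor, a cross approximation
    [g l x ~ sum_(j, k) g l (x k) * c k j * g (l j) x] loses only a factor polynomial in [r],
    so it is as accurate as wanted.  Its factors are slices of [g] itself, hence
    holomorphic on the whole of [U] or [W], whatever the accuracy.
    Iterating over all variables approximates [F] by finite sums of products of functions
    of one variable; averaging over permutations of both groups of variables and
    polarizing turns these products into [n]-th powers.  Finally the differences of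
    successive approximations form the series, each difference being repeated [m] times
    with weight [1/m] so that intermediate partial sums stay under control. *)

(** * Integrals over rectangles *)

(** The factors must be holomorphic on one neighborhood of [K] while the accuracy improves. Cauchy's
    formula only yields functions near small squares, and cutting them off to glue them over a
    compact set of arbitrary shape destroys holomorphy. The expansion therefore serves only to bound
    the distance to functions of low rank. The loss in the cross approximation is harmless because
    the number [m] of squares is fixed before the degree [d]: the rank is [m * d], the error decays
    like [(/ 16) ^ d], and the loss is quadratic in the rank. Coefficients, signs included,
    disappear into an [n]-th root, which exists because [0 < n]. The difference of two
    approximations may be small only through cancellation among large terms, hence the care with its
    partial sums. *)

Lemma Cmod_le_abs (z : C) : Cmod z <= Rabs (fst z) + Rabs (snd z).
Proof.
rewrite -{1}(_ : Cplus (RtoC (fst z)) (Cmult Ci (RtoC (snd z))) = z).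
  apply: Rle_trans (Cmod_triangle _ _) _.
  by rewrite Cmod_mult Cmod_Ci !Cmod_R; lra.
by case: z => x y; apply: injective_projections => /=; ring.
Qed.

Lemma Cmod_sub_sym (z w : C) : Cmod (z - w) = Cmod (w - z).
Proof. by rewrite -Cmod_opp; congr Cmod; ring. Qed.

Lemma Cmod_sub_le (x y z : C) : Cmod (x - z) <= Cmod (x - y) + Cmod (y - z).
Proof. by rewrite (_ : (x - z = (x - y) + (y - z))%C); [apply: Cmod_triangle|ring]. Qed.

Lemma Cmod_sub_ge (x y : C) : Cmod x - Cmod y <= Cmod (x - y).
Proof.
have := Cmod_triangle (x - y) y.
by rewrite (_ : (x - y + y = x)%C); [lra|ring].
Qed.

Definition Ccont (f : C -> C) (z : C) : Prop :=
  forall eps, 0 < eps -> exists d, 0 < d /\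
    forall w, Cmod (w - z) < d -> Cmod (f w - f z) < eps.

Lemma Cdiff_cont (f : C -> C) z : Cdifferentiable_at f z -> Ccont f z.
Proof.
move=> [a ha] eps heps.
have [d [hd h]] := ha 1 Rlt_0_1.
have ha0 := Cmod_ge_0 a.
exists (Rmin d (eps / (Cmod a + 2))); split.
  by apply: Rmin_pos => //; apply: Rdiv_lt_0_compat; lra.
move=> w hw.
have h1 : Cmod (w - z) < d by apply: Rlt_le_trans hw (Rmin_l _ _).
have h2 : Cmod (w - z) < eps / (Cmod a + 2) by apply: Rlt_le_trans hw (Rmin_r _ _).
have {h}h : Cmod ((f w - f z) - a * (w - z)) <= 1 * Cmod (w - z) := h w h1.
have h3 := Cmod_sub_ge (f w - f z) (a * (w - z)).
rewrite Cmod_mult in h3.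
have h4 : Cmod (f w - f z) <= (Cmod a + 1) * Cmod (w - z) by lra.
have h5 : (Cmod a + 2) * Cmod (w - z) < eps.
  have -> : eps = (Cmod a + 2) * (eps / (Cmod a + 2)) by field; lra.
  by apply: Rmult_lt_compat_l => //; lra.
by have := Cmod_ge_0 (w - z); nra.
Qed.

Lemma Ccont_affine (a b : C) z : Ccont (fun s => a + b * s)%C z.
Proof.
move=> eps heps; have hb := Cmod_ge_0 b.
exists (eps / (Cmod b + 1)); split; first by apply: Rdiv_lt_0_compat; lra.
move=> w hw.
rewrite (_ : (a + b * w - (a + b * z) = b * (w - z))%C); last by ring.
rewrite Cmod_mult.
have h5 : (Cmod b + 1) * Cmod (w - z) < eps.
  have -> : eps = (Cmod b + 1) * (eps / (Cmod b + 1)) by field; lra.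
  by apply: Rmult_lt_compat_l => //; lra.
by have := Cmod_ge_0 (w - z); nra.
Qed.

Lemma Ccont_lin (f g : C -> C) c z :
  Ccont f z -> Ccont g z -> Ccont (fun s => c * f s + g s)%C z.
Proof.
move=> hf hg eps heps; have hc := Cmod_ge_0 c.
have e1 : 0 < eps / (2 * (Cmod c + 1)) by apply: Rdiv_lt_0_compat; lra.
have e2 : 0 < eps / 2 by lra.
have [d1 [hd1 h1]] := hf _ e1.
have [d2 [hd2 h2]] := hg _ e2.
exists (Rmin d1 d2); split; first exact: Rmin_pos.
move=> w hw.
have {}h1 := h1 w (Rlt_le_trans _ _ _ hw (Rmin_l _ _)).
have {}h2 := h2 w (Rlt_le_trans _ _ _ hw (Rmin_r _ _)).
rewrite (_ : (c * f w + g w - (c * f z + g z) = c * (f w - f z) + (g w - g z))%C); last by ring.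
apply: Rle_lt_trans (Cmod_triangle _ _) _; rewrite Cmod_mult.
have h5 : (Cmod c + 1) * Cmod (f w - f z) < eps / 2.
  have -> : eps / 2 = (Cmod c + 1) * (eps / (2 * (Cmod c + 1))) by field; lra.
  by apply: Rmult_lt_compat_l => //; lra.
by have := Cmod_ge_0 (f w - f z); nra.
Qed.

(** Coquelicot's integrals leave equations typed in the carrier of a module; [ring] recognizes them
    once the type is restated as [R]. *)
Ltac Rring := match goal with |- @eq _ ?a ?b => change (@eq R a b); ring end.

Definition RCcont (g : R -> C) t : Prop :=
  continuous (fun u => fst (g u)) t /\ continuous (fun u => snd (g u)) t.

Lemma Ccont_path (f : C -> C) (p : R -> C) t :
  (forall u, Cmod (p u - p t) = Rabs (u - t)) -> Ccont f (p t) ->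
  RCcont (fun u => f (p u)) t.
Proof.
move=> hp hf.
have aux (k : C -> R) : (forall x y, Rabs (k x - k y) <= Cmod (x - y)) ->
    continuous (fun u => k (f (p u))) t.
  move=> hk; apply/continuity_pt_filterlim => eps heps.
  have [d [hd h]] := hf eps heps.
  exists d; split => // u [_]; rewrite /= /Rdist => hu.
  apply: Rle_lt_trans (hk _ _) _; apply: h; by rewrite hp.
split.
- by apply: (aux fst) => x y; apply: Rle_trans (Rmax_Cmod (x - y)%C); apply: Rmax_l.
- by apply: (aux snd) => x y; apply: Rle_trans (Rmax_Cmod (x - y)%C); apply: Rmax_r.
Qed.

Lemma hpath_dist y (u t : R) : Cmod ((u, y) - (t, y)) = Rabs (u - t).
Proof.
by rewrite -Cmod_R; congr Cmod; apply: injective_projections => /=; ring.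
Qed.

Lemma vpath_dist x (u t : R) : Cmod ((x, u) - (x, t)) = Rabs (u - t).
Proof.
rewrite -Cmod_R -[Cmod (RtoC _)]Rmult_1_l -Cmod_Ci -Cmod_mult; congr Cmod.
by apply: injective_projections => /=; ring.
Qed.

Lemma Ccont_h f x y : Ccont f (x, y) -> RCcont (fun u => f (u, y)) x.
Proof. by apply: (Ccont_path (p := fun u => (u, y))) => u; apply: hpath_dist. Qed.

Lemma Ccont_v f x y : Ccont f (x, y) -> RCcont (fun u => f (x, u)) y.
Proof. by apply: (Ccont_path (p := fun u => (x, u))) => u; apply: vpath_dist. Qed.

Definition Cint (g : R -> C) a b : C :=
  (RInt (fun t => fst (g t)) a b, RInt (fun t => snd (g t)) a b).

Definition seg_cont (g : R -> C) a b := forall t, a <= t <= b -> RCcont g t.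

Lemma seg_cont_ex g a b : a <= b -> seg_cont g a b ->
  ex_RInt (fun t => fst (g t)) a b /\ ex_RInt (fun t => snd (g t)) a b.
Proof.
move=> hab hg; split; apply: ex_RInt_continuous => z;
  rewrite Rmin_left ?Rmax_right // => hz; by case: (hg z hz).
Qed.

Lemma Cint_lin g h c a b : a <= b -> seg_cont g a b -> seg_cont h a b ->
  Cint (fun t => c * g t + h t)%C a b = (c * Cint g a b + Cint h a b)%C.
Proof.
move=> hab /(seg_cont_ex hab) [g1 g2] /(seg_cont_ex hab) [h1 h2].
have aux (p q : R) (u v w : R -> R) : ex_RInt u a b -> ex_RInt v a b -> ex_RInt w a b ->
   RInt (fun t => p * u t + q * v t + w t) a b = p * RInt u a b + q * RInt v a b + RInt w a b.
  move=> hu hv hw.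
  have e1 := ex_RInt_scal u a b p hu.
  have e2 := ex_RInt_scal v a b q hv.
  have e3 := ex_RInt_plus _ _ a b e1 e2.
  have s1 : RInt (fun t => p * u t) a b = p * RInt u a b := RInt_scal u a b p hu.
  have s2 : RInt (fun t => q * v t) a b = q * RInt v a b := RInt_scal v a b q hv.
  rewrite -s1 -s2.
  have := RInt_plus _ _ a b e1 e2; have := RInt_plus _ _ a b e3 hw.
  by rewrite /plus /scal /= /mult /= => -> ->.
apply: injective_projections => /=.
- apply: etrans.
    apply: (RInt_ext _ (fun t => fst c * fst (g t) + (- snd c) * snd (g t) + fst (h t))) => t _ /=.
    by Rring.
  by rewrite aux //; Rring.
- apply: etrans.
    apply: (RInt_ext _ (fun t => fst c * snd (g t) + snd c * fst (g t) + snd (h t))) => t _ /=.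
    by Rring.
  by rewrite aux //; Rring.
Qed.

Lemma Cint_Chasles g a b c : a <= b -> b <= c -> seg_cont g a c ->
  (Cint g a b + Cint g b c = Cint g a c)%C.
Proof.
move=> hab hbc hg.
have [|g1 g2] := @seg_cont_ex g a b hab; first by move=> t ht; apply: hg; lra.
have [|g3 g4] := @seg_cont_ex g b c hbc; first by move=> t ht; apply: hg; lra.
apply: injective_projections => /=.
- exact: (RInt_Chasles (V := R_CompleteNormedModule)).
- exact: (RInt_Chasles (V := R_CompleteNormedModule)).
Qed.

(** The real and imaginary integrals are bounded separately, which produces the factor 2. *)
Lemma Cint_bound g a b M : a <= b -> seg_cont g a b ->
  (forall t, a <= t <= b -> Cmod (g t) <= M) -> Cmod (Cint g a b) <= 2 * M * (b - a).
Proof.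
move=> hab hg hM; have [g1 g2] := seg_cont_ex hab hg.
apply: Rle_trans (Cmod_le_abs _) _ => /=.
have b1 : Rabs (RInt (fun t => fst (g t)) a b) <= (b - a) * M.
  apply: abs_RInt_le_const => // t ht.
  exact: Rle_trans (Rle_trans _ _ _ (Rmax_l _ _) (Rmax_Cmod (g t))) (hM t ht).
have b2 : Rabs (RInt (fun t => snd (g t)) a b) <= (b - a) * M.
  apply: abs_RInt_le_const => // t ht.
  exact: Rle_trans (Rle_trans _ _ _ (Rmax_r _ _) (Rmax_Cmod (g t))) (hM t ht).
lra.
Qed.

Lemma Cint_ext g h a b : a <= b -> (forall t, a <= t <= b -> g t = h t) ->
  Cint g a b = Cint h a b.
Proof.
move=> hab e; rewrite /Cint; congr pair; apply: RInt_ext => t;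
  rewrite Rmin_left ?Rmax_right // => ht; rewrite e //; lra.
Qed.

(** The contour integral over the boundary, counterclockwise; on the vertical sides
    [dz = Ci * dt]. *)
Definition rect_int (f : C -> C) x0 x1 y0 y1 : C :=
  (Cint (fun t => f (t, y0)) x0 x1 + Ci * Cint (fun t => f (x1, t)) y0 y1
   - Cint (fun t => f (t, y1)) x0 x1 - Ci * Cint (fun t => f (x0, t)) y0 y1)%C.

Definition edge x0 x1 y0 y1 (z : C) : Prop :=
  x0 <= fst z <= x1 /\ (snd z = y0 \/ snd z = y1) \/
  y0 <= snd z <= y1 /\ (fst z = x0 \/ fst z = x1).

Definition in_rect x0 x1 y0 y1 (z : C) : Prop :=
  x0 <= fst z <= x1 /\ y0 <= snd z <= y1.

Lemma edge_in_rect x0 x1 y0 y1 z : x0 <= x1 -> y0 <= y1 ->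
  edge x0 x1 y0 y1 z -> in_rect x0 x1 y0 y1 z.
Proof. by move=> hx hy [[h [e|e]]|[h [e|e]]]; split => //; rewrite e; lra. Qed.

Section RectInt.
Variables (x0 x1 y0 y1 : R).
Hypotheses (hx : x0 <= x1) (hy : y0 <= y1).

Lemma edge_seg_cont f : (forall z, edge x0 x1 y0 y1 z -> Ccont f z) ->
  [/\ seg_cont (fun t => f (t, y0)) x0 x1, seg_cont (fun t => f (x1, t)) y0 y1,
      seg_cont (fun t => f (t, y1)) x0 x1 & seg_cont (fun t => f (x0, t)) y0 y1].
Proof.
move=> hf; split => t ht.
- by apply: Ccont_h; apply: hf; left; split => //=; left.
- by apply: Ccont_v; apply: hf; right; split => //=; right.
- by apply: Ccont_h; apply: hf; left; split => //=; right.
- by apply: Ccont_v; apply: hf; right; split => //=; left.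
Qed.

Lemma rect_int_lin f g c :
  (forall z, edge x0 x1 y0 y1 z -> Ccont f z) ->
  (forall z, edge x0 x1 y0 y1 z -> Ccont g z) ->
  rect_int (fun s => c * f s + g s)%C x0 x1 y0 y1
  = (c * rect_int f x0 x1 y0 y1 + rect_int g x0 x1 y0 y1)%C.
Proof.
move=> /edge_seg_cont [f1 f2 f3 f4] /edge_seg_cont [g1 g2 g3 g4].
by rewrite /rect_int !Cint_lin //; ring.
Qed.

Lemma rect_int_ext f g : (forall z, edge x0 x1 y0 y1 z -> f z = g z) ->
  rect_int f x0 x1 y0 y1 = rect_int g x0 x1 y0 y1.
Proof.
move=> e; rewrite /rect_int.
rewrite (Cint_ext (g := fun t => f (t, y0)) (h := fun t => g (t, y0))) //; last first.
  by move=> t ht; apply: e; left; split => //=; left.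
rewrite (Cint_ext (g := fun t => f (x1, t)) (h := fun t => g (x1, t))) //; last first.
  by move=> t ht; apply: e; right; split => //=; right.
rewrite (Cint_ext (g := fun t => f (t, y1)) (h := fun t => g (t, y1))) //; last first.
  by move=> t ht; apply: e; left; split => //=; right.
rewrite (Cint_ext (g := fun t => f (x0, t)) (h := fun t => g (x0, t))) // => t ht.
by apply: e; right; split => //=; left.
Qed.

Lemma rect_int_bound f M :
  (forall z, edge x0 x1 y0 y1 z -> Ccont f z) ->
  (forall z, edge x0 x1 y0 y1 z -> Cmod (f z) <= M) ->
  Cmod (rect_int f x0 x1 y0 y1) <= 4 * M * ((x1 - x0) + (y1 - y0)).
Proof.
move=> /edge_seg_cont [f1 f2 f3 f4] hM; rewrite /rect_int.
have b1 : Cmod (Cint (fun t => f (t, y0)) x0 x1) <= 2 * M * (x1 - x0).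
  by apply: Cint_bound => // t ht; apply: hM; left; split => //=; left.
have b2 : Cmod (Cint (fun t => f (x1, t)) y0 y1) <= 2 * M * (y1 - y0).
  by apply: Cint_bound => // t ht; apply: hM; right; split => //=; right.
have b3 : Cmod (Cint (fun t => f (t, y1)) x0 x1) <= 2 * M * (x1 - x0).
  by apply: Cint_bound => // t ht; apply: hM; left; split => //=; right.
have b4 : Cmod (Cint (fun t => f (x0, t)) y0 y1) <= 2 * M * (y1 - y0).
  by apply: Cint_bound => // t ht; apply: hM; right; split => //=; left.
apply: Rle_trans (Cmod_triangle _ _) _; rewrite Cmod_opp Cmod_mult Cmod_Ci.
set A := Cmod (_ - _).
have : A <= Cmod (Cint (fun t => f (t, y0)) x0 x1) + 1 * Cmod (Cint (fun t => f (x1, t)) y0 y1)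
   + Cmod (Cint (fun t => f (t, y1)) x0 x1).
  rewrite /A; apply: Rle_trans (Cmod_triangle _ _) _; rewrite Cmod_opp.
  apply: Rplus_le_compat_r; apply: Rle_trans (Cmod_triangle _ _) _.
  by rewrite Cmod_mult Cmod_Ci; lra.
lra.
Qed.

End RectInt.

(** The integrals along the common side cancel identically, which is why continuity is assumed only
    along the two horizontal sides. *)
Lemma rect_int_split_x f x0 x1 x2 y0 y1 : x0 <= x1 -> x1 <= x2 ->
  (forall t, x0 <= t <= x2 -> Ccont f (t, y0) /\ Ccont f (t, y1)) ->
  (rect_int f x0 x2 y0 y1 = rect_int f x0 x1 y0 y1 + rect_int f x1 x2 y0 y1)%C.
Proof.
move=> h01 h12 hf; rewrite /rect_int.
rewrite -(@Cint_Chasles (fun t => f (t, y0)) x0 x1 x2) //; last first.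
  by move=> t ht; apply: Ccont_h; case: (hf t ht).
rewrite -(@Cint_Chasles (fun t => f (t, y1)) x0 x1 x2) //; last first.
  by move=> t ht; apply: Ccont_h; case: (hf t ht).
ring.
Qed.

Lemma rect_int_split_y f x0 x1 y0 y1 y2 : y0 <= y1 -> y1 <= y2 ->
  (forall t, y0 <= t <= y2 -> Ccont f (x0, t) /\ Ccont f (x1, t)) ->
  (rect_int f x0 x1 y0 y2 = rect_int f x0 x1 y0 y1 + rect_int f x0 x1 y1 y2)%C.
Proof.
move=> h01 h12 hf; rewrite /rect_int.
rewrite -(@Cint_Chasles (fun t => f (x0, t)) y0 y1 y2) //; last first.
  by move=> t ht; apply: Ccont_v; case: (hf t ht).
rewrite -(@Cint_Chasles (fun t => f (x1, t)) y0 y1 y2) //; last first.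
  by move=> t ht; apply: Ccont_v; case: (hf t ht).
ring.
Qed.

Lemma RInt_affine p q a b :
  RInt (fun t => p + q * t) a b = p * (b - a) + q * (b ^ 2 - a ^ 2) / 2.
Proof.
apply: is_RInt_unique.
have -> : p * (b - a) + q * (b ^ 2 - a ^ 2) / 2
  = minus (p * b + q * b ^ 2 / 2) (p * a + q * a ^ 2 / 2).
  by rewrite /minus /plus /opp /=; field.
apply: (is_RInt_derive (fun t => p * t + q * t ^ 2 / 2)) => x _.
- by auto_derive => //; field.
- by apply: ex_derive_continuous; auto_derive.
Qed.

(** Explicit primitives settle the affine case. In [goursat] it allows the tangent map to be
    subtracted before the integral is estimated. *)
Lemma rect_int_affine (a b : C) x0 x1 y0 y1 :
  rect_int (fun s => a + b * s)%C x0 x1 y0 y1 = 0%C.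
Proof.
rewrite /rect_int /Cint.
case: a b => [a a'] [b b'].
have H (y : R) : Cint (fun t => (a, a') + (b, b') * (t, y))%C x0 x1 =
   ((a - b' * y) * (x1 - x0) + b * (x1 ^ 2 - x0 ^ 2) / 2,
    (a' + b * y) * (x1 - x0) + b' * (x1 ^ 2 - x0 ^ 2) / 2).
  rewrite -!RInt_affine; congr pair; apply: RInt_ext => t _ /=; Rring.
have V (x : R) : Cint (fun t => (a, a') + (b, b') * (x, t))%C y0 y1 =
   ((a + b * x) * (y1 - y0) + (- b') * (y1 ^ 2 - y0 ^ 2) / 2,
    (a' + b' * x) * (y1 - y0) + b * (y1 ^ 2 - y0 ^ 2) / 2).
  rewrite -!RInt_affine; congr pair; apply: RInt_ext => t _ /=; Rring.
rewrite -/(Cint _ _ _) H -/(Cint _ _ _) V -/(Cint _ _ _) H -/(Cint _ _ _) V.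
by apply: injective_projections => /=; field.
Qed.

(** * Goursat's theorem *)

Lemma nested_intervals (u v : nat -> R) :
  (forall k, u k <= u k.+1) -> (forall k, v k.+1 <= v k) -> (forall k, u k <= v k) ->
  exists X, forall k, u k <= X <= v k.
Proof.
move=> hu hv huv.
have mu k d : u k <= u (k + d)%N.
  elim: d => [|d IH]; first by rewrite addn0; lra.
  by rewrite addnS; apply: Rle_trans IH (hu _).
have mv k d : v (k + d)%N <= v k.
  elim: d => [|d IH]; first by rewrite addn0; lra.
  by rewrite addnS; apply: Rle_trans (hv _) IH.
have huv2 j k : u j <= v k.
  have h1 := mu j k; have h2 := mv k j; have h3 := huv (j + k)%N.
  by rewrite addnC in h2; lra.
have [||X [h1 h2]] := completeness (fun r => exists k, r = u k).
- by exists (v 0%N) => r [k ->].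
- by exists (u 0%N), 0%N.
exists X => k; split; first by apply: h1; exists k.
by apply: h2 => r [j ->].
Qed.

Lemma half_pow_pos k : 0 < (/ 2) ^ k.
Proof. by apply: pow_lt; lra. Qed.

Lemma half_pow_lt e : 0 < e -> exists k, (/ 2) ^ k < e.
Proof.
move=> he.
have [|N hN] := pow_lt_1_zero (/ 2) _ e he; first by rewrite Rabs_pos_eq; lra.
exists N; have := hN N (le_n N); rewrite Rabs_pos_eq //.
exact: Rlt_le (half_pow_pos N).
Qed.

(* Local-to-global by bisection: a failure of [Q] would persist in a nested
   sequence of similar rectangles shrinking to a point. *)
Lemma rect_bisection (w h x0 y0 : R) (Q : R -> R -> R -> Prop) :
  0 <= w -> 0 <= h ->
  (forall x y t, 0 < t -> x0 <= x -> x + w * t <= x0 + w -> y0 <= y -> y + h * t <= y0 + h ->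
     Q x y (t / 2) -> Q (x + w * (t / 2)) y (t / 2) ->
     Q x (y + h * (t / 2)) (t / 2) -> Q (x + w * (t / 2)) (y + h * (t / 2)) (t / 2) ->
     Q x y t) ->
  (forall X Y, x0 <= X <= x0 + w -> y0 <= Y <= y0 + h ->
     exists d, 0 < d /\ forall x y t, 0 < t < d -> x <= X <= x + w * t -> y <= Y <= y + h * t -> 
       x0 <= x -> x + w * t <= x0 + w -> y0 <= y -> y + h * t <= y0 + h -> Q x y t) ->
  Q x0 y0 1.
Proof.
move=> hw hh hQ hloc; apply: NNPP => nQ.
pose ok (p : R * R) t := [/\ x0 <= p.1, p.1 + w * t <= x0 + w, y0 <= p.2, p.2 + h * t <= y0 + h & ~ Q p.1 p.2 t].
(* The hypotheses are placed under the existential, so that the choice function [nx] is total. *)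
have step p t : exists p', 0 < t -> ok p t ->
   [/\ ok p' (t / 2), p.1 <= p'.1, p'.1 + w * (t / 2) <= p.1 + w * t,
       p.2 <= p'.2 & p'.2 + h * (t / 2) <= p.2 + h * t].
  case: (classic (0 < t /\ ok p t)) => [[ht [a1 a2 a3 a4 a5]]|nok]; last first.
    by exists p => ht hok; case: nok.
  have wt : 0 <= w * (t / 2) by apply: Rmult_le_pos; lra.
  have ht' : 0 <= h * (t / 2) by apply: Rmult_le_pos; lra.
  case: (classic (Q p.1 p.2 (t / 2))) => q1; last first.
    by exists p => _ _; split; [split => //; lra|lra..].
  case: (classic (Q (p.1 + w * (t / 2)) p.2 (t / 2))) => q2; last first.
    by exists (p.1 + w * (t / 2), p.2) => _ _; split => /=; [split => //=; lra|lra..].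
  case: (classic (Q p.1 (p.2 + h * (t / 2)) (t / 2))) => q3; last first.
    by exists (p.1, p.2 + h * (t / 2)) => _ _; split => /=; [split => //=; lra|lra..].
  exists (p.1 + w * (t / 2), p.2 + h * (t / 2)) => _ _; split => /=; [split => //=; try lra|lra..].
  by move=> q4; apply: a5; apply: hQ.
have [nx hnx] : exists nx : R * R -> R -> R * R, forall p t, 0 < t -> ok p t ->
   [/\ ok (nx p t) (t / 2), p.1 <= (nx p t).1, (nx p t).1 + w * (t / 2) <= p.1 + w * t,
       p.2 <= (nx p t).2 & (nx p t).2 + h * (t / 2) <= p.2 + h * t].
  exists (fun p t => proj1_sig (constructive_indefinite_description _ (step p t))) => p t.
  by case: constructive_indefinite_description.
pose s k := nat_rect (fun _ => (R * R)%type) (x0, y0) (fun k p => nx p ((/ 2) ^ k)) k.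
have eS k : (/ 2) ^ k.+1 = (/ 2) ^ k / 2 by rewrite /=; field.
have oks k : ok (s k) ((/ 2) ^ k).
  elim: k => [|k IH]; first by split => //=; lra.
  by rewrite eS; have [] := hnx _ _ (half_pow_pos k) IH.
have [X hX] : exists X, forall k, (s k).1 <= X <= (s k).1 + w * (/ 2) ^ k.
  apply: (@nested_intervals (fun k => (s k).1) (fun k => (s k).1 + w * (/ 2) ^ k)) => k.
  - by have [] := hnx _ _ (half_pow_pos k) (oks k).
  - by rewrite eS; have [] := hnx _ _ (half_pow_pos k) (oks k).
  - by have := Rmult_le_pos _ _ hw (Rlt_le _ _ (half_pow_pos k)); lra.
have [Y hY] : exists Y, forall k, (s k).2 <= Y <= (s k).2 + h * (/ 2) ^ k.
  apply: (@nested_intervals (fun k => (s k).2) (fun k => (s k).2 + h * (/ 2) ^ k)) => k.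
  - by have [] := hnx _ _ (half_pow_pos k) (oks k).
  - by rewrite eS; have [] := hnx _ _ (half_pow_pos k) (oks k).
  - by have := Rmult_le_pos _ _ hh (Rlt_le _ _ (half_pow_pos k)); lra.
have [||d [hd hdQ]] := hloc X Y.
- by have := hX 0%N; rewrite /=; lra.
- by have := hY 0%N; rewrite /=; lra.
have [k hk] := half_pow_lt hd.
have [a1 a2 a3 a4 a5] := oks k.
by apply: a5; apply: hdQ => //; split => //; apply: half_pow_pos.
Qed.

Lemma goursat (f : C -> C) x0 x1 y0 y1 : x0 <= x1 -> y0 <= y1 ->
  (forall z, in_rect x0 x1 y0 y1 z -> Cdifferentiable_at f z) ->
  rect_int f x0 x1 y0 y1 = 0%C.
Proof.
move=> hx hy hf.
pose w := x1 - x0; pose h := y1 - y0.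
have hw : 0 <= w by rewrite /w; lra.
have hh : 0 <= h by rewrite /h; lra.
suff H eta : 0 < eta -> Cmod (rect_int f x0 x1 y0 y1) <= eta.
  apply: Cmod_eq_0; apply: Rle_antisym; last exact: Cmod_ge_0.
  by apply: Rnot_lt_le => hpos; have := H (Cmod (rect_int f x0 x1 y0 y1) / 2); lra.
move=> heta.
(* The target scales like the area, as [t ^ 2], so the estimates for the four halved rectangles add
   up to the one for the whole. *)
suff : Cmod (rect_int f x0 (x0 + w * 1) y0 (y0 + h * 1)) <= eta * 1 ^ 2.
  by rewrite /w /h !Rmult_1_r pow1 Rmult_1_r !Rplus_minus.
have ex1 : x1 = x0 + w by rewrite /w; ring.
have ey1 : y1 = y0 + h by rewrite /h; ring.
apply: (@rect_bisection w h x0 y0 (fun x y t =>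
  Cmod (rect_int f x (x + w * t) y (y + h * t)) <= eta * t ^ 2)) => //.
- move=> x y t ht a1 a2 a3 a4 q1 q2 q3 q4.
  have wt : 0 <= w * (t / 2) by apply: Rmult_le_pos; lra.
  have ht' : 0 <= h * (t / 2) by apply: Rmult_le_pos; lra.
  have hc a b : x <= a <= x + w * t -> y <= b <= y + h * t -> Ccont f (a, b).
    by move=> ha hb; apply: Cdiff_cont; apply: hf; split => /=; lra.
  rewrite (@rect_int_split_x f x (x + w * (t / 2)) (x + w * t)); [|lra|lra|]; last first.
    by move=> a ha; split; apply: hc; lra.
  rewrite (@rect_int_split_y f _ _ y (y + h * (t / 2)) (y + h * t)); [|lra|lra|]; last first.
    by move=> a ha; split; apply: hc; lra.
  rewrite (@rect_int_split_y f _ _ y (y + h * (t / 2)) (y + h * t)); [|lra|lra|]; last first.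
    by move=> a ha; split; apply: hc; lra.
  have ex : x + w * t = x + w * (t / 2) + w * (t / 2) by field.
  have ey : y + h * t = y + h * (t / 2) + h * (t / 2) by field.
  rewrite ex ey.
  apply: Rle_trans (Cmod_triangle _ _) _.
  have t1 := Cmod_triangle (rect_int f x (x + w * (t / 2)) y (y + h * (t / 2)))
    (rect_int f x (x + w * (t / 2)) (y + h * (t / 2)) (y + h * (t / 2) + h * (t / 2))).
  have t2 := Cmod_triangle (rect_int f (x + w * (t / 2)) (x + w * (t / 2) + w * (t / 2)) y (y + h * (t / 2)))
    (rect_int f (x + w * (t / 2)) (x + w * (t / 2) + w * (t / 2)) (y + h * (t / 2)) (y + h * (t / 2) + h * (t / 2))).
  have -> : eta * t ^ 2 = 4 * (eta * (t / 2) ^ 2) by field.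
  lra.
- move=> X Y hX hY.
  have [|a ha] := hf (X, Y); first by split => /=; lra.
  (* At scale 1, [L] dominates the half-perimeter and the distance to [(X, Y)]; the summand 1 keeps
     it positive for degenerate rectangles. *)
  pose L := w + h + 1; have hL : 1 <= L by rewrite /L; lra.
  have he : 0 < eta / (4 * L ^ 2) by apply: Rdiv_lt_0_compat; nra.
  have [d [hd hda]] := ha _ he.
  exists (d / L); split; first by apply: Rdiv_lt_0_compat; lra.
  move=> x y t [ht htd] bX bY a1 a2 a3 a4.
  have wt : 0 <= w * t by apply: Rmult_le_pos; lra.
  have ht' : 0 <= h * t by apply: Rmult_le_pos; lra.
  have htL : L * t < d.
    have -> : d = L * (d / L) by field; lra.
    by apply: Rmult_lt_compat_l => //; lra.
  pose al := (f (X, Y) - a * (X, Y))%C.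
  have hcf z : edge x (x + w * t) y (y + h * t) z -> Ccont f z.
    have e1 : x <= x + w * t by lra.
    have e2 : y <= y + h * t by lra.
    move=> /(edge_in_rect e1 e2) [b1 b2].
    by apply: Cdiff_cont; apply: hf; split; lra.
  (* Subtracting the tangent map at [(X, Y)] does not change the integral and leaves an integrand
     small compared with [t]. *)
  have -> : rect_int f x (x + w * t) y (y + h * t)
      = rect_int (fun s => (- (1)) * (al + a * s) + f s)%C x (x + w * t) y (y + h * t).
    rewrite rect_int_lin //; [|lra|lra|]; last by move=> z _; apply: Ccont_affine.
    by rewrite rect_int_affine; ring.
  have -> : eta * t ^ 2 = 4 * (eta / (4 * L ^ 2) * (L * t)) * (L * t) by field; lra.
  apply: Rle_trans (@rect_int_bound _ _ _ _ _ _ _ (eta / (4 * L ^ 2) * (L * t)) _ _) _; [lra|lra| | |].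
  + by move=> z hz; apply: Ccont_lin; [apply: Ccont_affine|apply: hcf].
  + move=> z hz.
    have [b1 b2] : in_rect x (x + w * t) y (y + h * t) z by apply: edge_in_rect hz; lra.
    have hzd : Cmod (z - (X, Y)) <= L * t.
      apply: Rle_trans (Cmod_le_abs _) _ => /=.
      have : Rabs (fst z + - X) <= w * t by apply: Rabs_le; lra.
      have : Rabs (snd z + - Y) <= h * t by apply: Rabs_le; lra.
      by rewrite /L; nra.
    have hz2 := hda z (Rle_lt_trans _ _ _ hzd htL).
    rewrite (_ : (- (1) * (al + a * z) + f z)%C = ((f z - f (X, Y)) - a * (z - (X, Y)))%C); last first.
      by rewrite /al; ring.
    apply: Rle_trans hz2 _; apply: Rmult_le_compat_l; [lra|exact: hzd].
  apply: Rmult_le_compat_l.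
    by apply: Rmult_le_pos; [lra|apply: Rmult_le_pos; [lra|apply: Rmult_le_pos; lra]].
  by rewrite /L; nra.
Qed.

(** * Cauchy's formula on squares *)

Lemma Csub_neq0 (z l : C) : z <> l -> (z - l)%C <> 0%C.
Proof. by move=> n e; apply: n; rewrite -[z]/(z)%C (_ : z = (z - l) + l)%C; [rewrite e; ring|ring]. Qed.

(** The derivative is [(a - hz) / (z - l)], with [hz] the value of the quotient at [z]. After
    multiplication by [w - l] the error splits into the error of [f] and a quadratic term in
    [w - z]. *)
Lemma Cdiff_div (f : C -> C) z v l : z <> l -> Cdifferentiable_at f z ->
  Cdifferentiable_at (fun s => (f s - v) / (s - l))%C z.
Proof.
move=> nzl [a ha].
have nz := Csub_neq0 nzl.
pose D := Cmod (z - l); have hD : 0 < D by apply/Cmod_gt_0.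
pose hz := ((f z - v) / (z - l))%C.
pose b := ((a - hz) / (z - l))%C.
pose kb := Cmod b; have hk : 0 <= kb by apply: Cmod_ge_0.
exists b => eps heps.
have he : 0 < eps * D / 4 by nra.
have [d [hd hda]] := ha _ he.
(* [D / 2] keeps [w] away from [l]; the last radius makes the quadratic term at most [eps * D / 4]
   times the increment. *)
exists (Rmin d (Rmin (D / 2) (eps * D / (4 * (kb + 1))))); split.
  apply: Rmin_pos => //; apply: Rmin_pos; first by lra.
  by apply: Rdiv_lt_0_compat; nra.
move=> w hw.
have h1 : Cmod (w - z) < d by apply: Rlt_le_trans hw (Rmin_l _ _).
have h2 := Rlt_le_trans _ _ _ hw (Rmin_r _ _).
have h3 : Cmod (w - z) < D / 2 by apply: Rlt_le_trans h2 (Rmin_l _ _).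
have {}h2 : Cmod (w - z) < eps * D / (4 * (kb + 1)) by apply: Rlt_le_trans h2 (Rmin_r _ _).
have {hda} h4 : Cmod ((f w - f z) - a * (w - z)) <= eps * D / 4 * Cmod (w - z) := hda w h1.
have h5 : D / 2 <= Cmod (w - l).
  have := Cmod_sub_le z w l; rewrite (Cmod_sub_sym z w) -/D; lra.
have nw : (w - l)%C <> 0%C by apply/Cmod_gt_0; lra.
change (Cmod (((f w - v) / (w - l) - (f z - v) / (z - l)) - b * (w - z)) <= eps * Cmod (w - z)).
rewrite (_ : (((f w - v) / (w - l) - (f z - v) / (z - l)) - b * (w - z) =
   ((f w - f z - a * (w - z)) - b * ((w - z) * (w - z))) / (w - l))%C); last first.
  by rewrite /b /hz; field.
rewrite Cmod_div //.
apply: (Rmult_le_reg_r (Cmod (w - l))); first by lra.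
rewrite /Rdiv Rmult_assoc Rinv_l ?Rmult_1_r; last by lra.
apply: Rle_trans (Cmod_triangle _ _) _; rewrite Cmod_opp (Cmod_mult b) (Cmod_mult (w - z)%C) -/kb.
have hm := Cmod_ge_0 (w - z).
have h6 : (kb + 1) * Cmod (w - z) <= eps * D / 4.
  have -> : eps * D / 4 = (kb + 1) * (eps * D / (4 * (kb + 1))) by field; lra.
  by apply: Rmult_le_compat_l; lra.
have h7 : kb * (Cmod (w - z) * Cmod (w - z)) <= eps * D / 4 * Cmod (w - z) by nra.
have h8 : eps * Cmod (w - z) * (D / 2) <= eps * Cmod (w - z) * Cmod (w - l).
  by apply: Rmult_le_compat_l => //; nra.
nra.
Qed.

(** The quotient is holomorphic away from [(a, b)] and bounded near it, so Goursat's theorem shrinks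
    the contour to a square of half-side [e], where the integral is of order [e]. *)
Lemma goursat_removable (f : C -> C) x0 x1 y0 y1 a b :
  x0 < a < x1 -> y0 < b < y1 ->
  (forall z, in_rect x0 x1 y0 y1 z -> Cdifferentiable_at f z) ->
  rect_int (fun s => (f s - f (a, b)) / (s - (a, b)))%C x0 x1 y0 y1 = 0%C.
Proof.
move=> ha hb hf.
set g := (X in rect_int X _ _ _ _).
have hg z : in_rect x0 x1 y0 y1 z -> z <> (a, b) -> Cdifferentiable_at g z.
  by move=> hz nz; apply: Cdiff_div => //; apply: hf.
have hgx x y : x0 <= x <= x1 -> y0 <= y <= y1 -> x <> a \/ y <> b -> Ccont g (x, y).
  move=> hx hy n; apply: Cdiff_cont; apply: hg; first by split.
  by case=> e1 e2; case: n.
have [df [hdf]] : exists df, (exists d, 0 < d /\ forall w, Cmod (w - (a, b)) < d ->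
    Cmod (f w - f (a, b) - df * (w - (a, b))) <= 1 * Cmod (w - (a, b))).
  have [|df hdf] := hf (a, b); first by split => /=; lra.
  by exists df; apply: (hdf 1); lra.
case=> hdf0 hdfe.
pose M := Cmod df + 1; have hM : 0 < M by have := Cmod_ge_0 df; rewrite /M; lra.
suff H e : 0 < e -> e < hdf / 2 -> e < a - x0 -> e < x1 - a -> e < b - y0 -> e < y1 - b ->
    Cmod (rect_int g x0 x1 y0 y1) <= 16 * M * e.
  apply: Cmod_eq_0; apply: Rle_antisym; last exact: Cmod_ge_0.
  apply: Rnot_lt_le => hpos.
  set I := Cmod _ in H hpos.
  (* The bounds on [e] are strict, so [H] is applied to [e1 / 2]; the last term of the minimum then
     gives [I <= I / 2], contradicting [0 < I]. *)
  pose e1 := Rmin (hdf / 2) (Rmin (Rmin (a - x0) (x1 - a)) (Rmin (Rmin (b - y0) (y1 - b)) (I / (16 * M)))).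
  have he1 : 0 < e1.
    by repeat apply: Rmin_pos; try lra; apply: Rdiv_lt_0_compat; lra.
  have m1 : e1 <= hdf / 2 by apply: Rmin_l.
  have m2 : e1 <= Rmin (Rmin (a - x0) (x1 - a)) (Rmin (Rmin (b - y0) (y1 - b)) (I / (16 * M))) by apply: Rmin_r.
  have m3 := Rle_trans _ _ _ m2 (Rmin_l _ _).
  have m4 := Rle_trans _ _ _ m2 (Rmin_r _ _).
  have m5 := Rle_trans _ _ _ m3 (Rmin_l _ _).
  have m6 := Rle_trans _ _ _ m3 (Rmin_r _ _).
  have m7 := Rle_trans _ _ _ m4 (Rmin_l _ _).
  have m8 := Rle_trans _ _ _ m4 (Rmin_r _ _).
  have m9 := Rle_trans _ _ _ m7 (Rmin_l _ _).
  have m10 := Rle_trans _ _ _ m7 (Rmin_r _ _).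
  have : I <= 16 * M * (e1 / 2) by apply: H; lra.
  have -> : 16 * M * (e1 / 2) = 8 * M * e1 by field.
  have : 16 * M * e1 <= I.
    have -> : I = 16 * M * (I / (16 * M)) by field; lra.
    by apply: Rmult_le_compat_l => //; lra.
  lra.
move=> he e1 e2 e3 e4 e5.
(* Four strips that avoid [(a, b)] are cut off: left, right, bottom, top. *)
have -> : rect_int g x0 x1 y0 y1 = rect_int g (a - e) (a + e) (b - e) (b + e).
  rewrite (@rect_int_split_x g x0 (a - e) x1); [|lra|lra|]; last first.
    by move=> t ht; split; apply: hgx; lra.
  rewrite (@goursat g x0 (a - e)); [|lra|lra|]; last first.
    by move=> z [z1 z2]; apply: hg; [split; lra|move=> ez; rewrite ez /= in z1; lra].
  rewrite (@rect_int_split_x g (a - e) (a + e) x1); [|lra|lra|]; last first.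
    by move=> t ht; split; apply: hgx; lra.
  rewrite (@goursat g (a + e) x1); [|lra|lra|]; last first.
    by move=> z [z1 z2]; apply: hg; [split; lra|move=> ez; rewrite ez /= in z1; lra].
  rewrite (@rect_int_split_y g _ _ y0 (b - e) y1); [|lra|lra|]; last first.
    by move=> t ht; split; apply: hgx; lra.
  rewrite (@goursat g _ _ y0 (b - e)); [|lra|lra|]; last first.
    by move=> z [z1 z2]; apply: hg; [split; lra|move=> ez; rewrite ez /= in z2; lra].
  rewrite (@rect_int_split_y g _ _ (b - e) (b + e) y1); [|lra|lra|]; last first.
    by move=> t ht; split; apply: hgx; lra.
  rewrite (@goursat g _ _ (b + e) y1); [|lra|lra|]; last first.
    by move=> z [z1 z2]; apply: hg; [split; lra|move=> ez; rewrite ez /= in z2; lra].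
  ring.
have -> : 16 * M * e = 4 * M * ((a + e - (a - e)) + (b + e - (b - e))) by ring.
have nab z : edge (a - e) (a + e) (b - e) (b + e) z -> z <> (a, b).
  by move=> hz ez; move: hz; rewrite ez => -[[_ /= []]|[_ /= []]]; lra.
have inr z : edge (a - e) (a + e) (b - e) (b + e) z -> in_rect (a - e) (a + e) (b - e) (b + e) z.
  by apply: edge_in_rect; lra.
apply: rect_int_bound; [lra|lra| |] => z hz.
  apply: Cdiff_cont; apply: hg; last exact: nab.
  by have [z1 z2] := inr z hz; split; lra.
have [z1 z2] := inr z hz.
have dz : Cmod (z - (a, b)) < hdf.
  apply: Rle_lt_trans (Cmod_le_abs _) _ => /=.
  have : Rabs (fst z + - a) <= e by apply: Rabs_le; lra.
  have : Rabs (snd z + - b) <= e by apply: Rabs_le; lra.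
  by lra.
have nz := Csub_neq0 (nab z hz).
rewrite /g Cmod_div //.
have p : 0 < Cmod (z - (a, b)) by apply/Cmod_gt_0.
apply: (Rmult_le_reg_r (Cmod (z - (a, b)))) => //.
rewrite /Rdiv Rmult_assoc Rinv_l ?Rmult_1_r; last by lra.
have := hdfe z dz.
have := Cmod_sub_ge (f z - f (a, b)) (df * (z - (a, b))).
by rewrite Cmod_mult /M; lra.
Qed.

Lemma RInt_ge_const (g : R -> R) a b m : a <= b -> ex_RInt g a b ->
  (forall t, a <= t <= b -> m <= g t) -> m * (b - a) <= RInt g a b.
Proof.
move=> hab eg hg.
have e : RInt (fun _ => m) a b = m * (b - a).
  by rewrite RInt_const /scal /= /mult /=; ring.
rewrite -e; apply: RInt_le => //; first exact: ex_RInt_const.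
by move=> t ht; apply: hg; lra.
Qed.

Lemma RInt_le_const (g : R -> R) a b m : a <= b -> ex_RInt g a b ->
  (forall t, a <= t <= b -> g t <= m) -> RInt g a b <= m * (b - a).
Proof.
move=> hab eg hg.
have e : RInt (fun _ => m) a b = m * (b - a).
  by rewrite RInt_const /scal /= /mult /=; ring.
rewrite -e; apply: RInt_le => //; first exact: ex_RInt_const.
by move=> t ht; apply: hg; lra.
Qed.

Definition square_int (c : C) r (f : C -> C) : C :=
  rect_int f (fst c - r) (fst c + r) (snd c - r) (snd c + r).

Definition in_square (c : C) r (z : C) : Prop :=
  in_rect (fst c - r) (fst c + r) (snd c - r) (snd c + r) z.

Definition square_edge (c : C) r (z : C) : Prop :=
  edge (fst c - r) (fst c + r) (snd c - r) (snd c + r) z.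

Lemma square_edge_far c r z : 0 < r -> square_edge c r z -> r <= Cmod (z - c).
Proof.
move=> hr [[_ [e|e]]|[_ [e|e]]]; apply: Rle_trans (Rmax_Cmod (z - c)%C) => /=; rewrite e.
- by apply: Rle_trans (Rmax_r _ _); rewrite Rabs_left; lra.
- by apply: Rle_trans (Rmax_r _ _); rewrite Rabs_right; lra.
- by apply: Rle_trans (Rmax_l _ _); rewrite Rabs_left; lra.
- by apply: Rle_trans (Rmax_l _ _); rewrite Rabs_right; lra.
Qed.

Lemma Cdiff_const v z : Cdifferentiable_at (fun _ => v) z.
Proof.
exists (RtoC 0) => eps heps; exists 1; split; first by lra.
move=> w _.
change (Cmod ((v - v) - RtoC 0 * (w - z)) <= eps * Cmod (w - z)).
rewrite (_ : (v - v - 0 * (w - z))%C = 0%C); last by ring.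
by rewrite Cmod_0; have := Cmod_ge_0 (w - z); nra.
Qed.

(* The [- 0] here and in [pole] makes the functions instances of [Cdiff_div]. *)
Definition ckernel (l s : C) : C := ((1 - 0) / (s - l))%C.

(** Stands in for the constant [2 * PI * Ci] of Cauchy's formula; [winding_lower] makes division by
    it safe. *)
Definition winding c r l := square_int c r (ckernel l).

Section Square.
Variables (c : C) (r : R) (l : C).
Hypotheses (hr : 0 < r) (hl : Cmod (l - c) <= r / 16).

Lemma near_center : Rabs (fst l - fst c) <= r / 16 /\ Rabs (snd l - snd c) <= r / 16.
Proof.
have h := Rmax_Cmod (l - c)%C; split.
- exact: Rle_trans (Rle_trans _ _ _ (Rmax_l _ _) h) hl.
- exact: Rle_trans (Rle_trans _ _ _ (Rmax_r _ _) h) hl.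
Qed.

Lemma square_edge_far_l z : square_edge c r z -> r / 2 <= Cmod (z - l).
Proof.
move=> /(square_edge_far hr) h.
by have := Cmod_sub_le z l c; lra.
Qed.

Lemma square_edge_neq z : square_edge c r z -> z <> l.
Proof.
move=> /square_edge_far_l h e; move: h.
by rewrite e (_ : (l - l)%C = 0%C) ?Cmod_0; [lra|ring].
Qed.

Lemma ckernel_cont z : square_edge c r z -> Ccont (ckernel l) z.
Proof.
move=> hz; apply: Cdiff_cont.
by apply: (@Cdiff_div (fun _ => 1%C)); [apply: square_edge_neq|apply: Cdiff_const].
Qed.

(** All four sides contribute to the imaginary part with the same sign. On the bottom side the
    integrand is at least [/ (4 * r)], and the length [2 * r] turns this into [/ 2]. *)
Lemma winding_lower : / 2 <= Cmod (winding c r l).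
Proof.
have [n1 n2] := near_center.
move/Rabs_le_between: n1 => n1; move/Rabs_le_between: n2 => n2.
apply: Rle_trans (Rmax_Cmod (winding c r l)); apply: Rle_trans (Rmax_r _ _).
apply: Rle_trans (Rle_abs _).
have hx : fst c - r <= fst c + r by lra.
have hy : snd c - r <= snd c + r by lra.
have [k1 k2 k3 k4] := edge_seg_cont ckernel_cont.
have [_ x1] := seg_cont_ex hx k1.
have [x2 _] := seg_cont_ex hy k2.
have [_ x3] := seg_cont_ex hx k3.
have [x4 _] := seg_cont_ex hy k4.
have kf z : fst (ckernel l z) = fst (z - l)%C / (fst (z - l)%C ^ 2 + snd (z - l)%C ^ 2).
  set w := (z - l)%C; set D := _ + _.
  change ((1 + - 0) * (fst w / D) - (0 + - 0) * (- snd w / D) = fst w / D).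
  by rewrite /Rdiv; ring.
have ks z : snd (ckernel l z) = - snd (z - l)%C / (fst (z - l)%C ^ 2 + snd (z - l)%C ^ 2).
  set w := (z - l)%C; set D := _ + _.
  change ((1 + - 0) * (- snd w / D) + (0 + - 0) * (fst w / D) = - snd w / D).
  by rewrite /Rdiv; ring.
have b1 := @RInt_ge_const _ _ _ (/ (4 * r)) hx x1.
have b2 := @RInt_ge_const _ _ _ 0 hy x2.
have b3 := @RInt_le_const _ _ _ 0 hx x3.
have b4 := @RInt_le_const _ _ _ 0 hy x4.
have pos (u v : R) : 0 < u -> 0 < u / (u ^ 2 + v ^ 2).
  by move=> hu; apply: Rdiv_lt_0_compat => //; nra.
have -> : snd (winding c r l) = RInt (fun t => snd (ckernel l (t, snd c - r))) (fst c - r) (fst c + r)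
   + RInt (fun t => fst (ckernel l (fst c + r, t))) (snd c - r) (snd c + r)
   - RInt (fun t => snd (ckernel l (t, snd c + r))) (fst c - r) (fst c + r)
   - RInt (fun t => fst (ckernel l (fst c - r, t))) (snd c - r) (snd c + r).
  by rewrite /winding /square_int /rect_int /Cint /=; Rring.
have {}b1 : / (4 * r) * (2 * r) <= RInt (fun t => snd (ckernel l (t, snd c - r))) (fst c - r) (fst c + r).
  rewrite (_ : 2 * r = fst c + r - (fst c - r)); last by ring.
  apply: b1 => t ht; rewrite ks /=.
  set u := t + _; set v := snd c - r + _.
  have hu : - (17 / 16 * r) <= u <= 17 / 16 * r by rewrite /u; lra.
  have hv : 15 / 16 * r <= - v <= 17 / 16 * r by rewrite /v; lra.
  apply: (Rmult_le_reg_r (u ^ 2 + v ^ 2)); first by nra.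
  rewrite /Rdiv Rmult_assoc Rinv_l ?Rmult_1_r; last by nra.
  apply: (Rmult_le_reg_l (4 * r)); first by lra.
  rewrite -Rmult_assoc Rinv_r ?Rmult_1_l; last by lra.
  by nra.
have {}b2 : 0 <= RInt (fun t => fst (ckernel l (fst c + r, t))) (snd c - r) (snd c + r).
  rewrite -(Rmult_0_l (snd c + r - (snd c - r))); apply: b2 => t ht; rewrite kf /=.
  by apply: Rlt_le; apply: pos; lra.
have {}b3 : RInt (fun t => snd (ckernel l (t, snd c + r))) (fst c - r) (fst c + r) <= 0.
  rewrite -[X in _ <= X](Rmult_0_l (fst c + r - (fst c - r))); apply: b3 => t ht; rewrite ks /=.
  set u := t + _; set v := snd c + r + _.
  have hv : 0 < v by rewrite /v; lra.
  have := pos v u hv; rewrite (Rplus_comm (v ^ 2)) /Rdiv Ropp_mult_distr_l_reverse /=; lra.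
have {}b4 : RInt (fun t => fst (ckernel l (fst c - r, t))) (snd c - r) (snd c + r) <= 0.
  rewrite -[X in _ <= X](Rmult_0_l (snd c + r - (snd c - r))); apply: b4 => t ht; rewrite kf /=.
  set v := t + _; set u := fst c - r + _.
  have hu : 0 < - u by rewrite /u; lra.
  have := pos _ v hu.
  rewrite (_ : (- u) ^ 2 = u ^ 2); last by ring.
  by rewrite /Rdiv Ropp_mult_distr_l_reverse /=; lra.
have : / (4 * r) * (2 * r) = / 2 by field; lra.
lra.
Qed.

End Square.

Ltac Cring := match goal with |- @eq _ ?a ?b => change (@eq C a b); ring end.

Lemma CaddA : associative Cadd.
Proof. by move=> x y z; apply: injective_projections => /=; ring. Qed.
Lemma CaddC : commutative Cadd.
Proof. by move=> x y; apply: injective_projections => /=; ring. Qed.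
Lemma Cadd0 : left_id C0 Cadd.
Proof. by move=> x; apply: injective_projections => /=; ring. Qed.

HB.instance Definition _ := Monoid.isComLaw.Build Cx C0 Cadd CaddA CaddC Cadd0.

(** This is [f s / (s - c) ^ k], as an iterated division so that [Cdiff_div] applies at each stage.
    The integrals of these functions take the place of Taylor coefficients. *)
Fixpoint pole (f : C -> C) (c : C) k : C -> C :=
  if k is k'.+1 then fun s => ((pole f c k' s - 0) / (s - c))%C else f.

Lemma pole_diff f c k z : z <> c -> Cdifferentiable_at f z ->
  Cdifferentiable_at (pole f c k) z.
Proof. by move=> hz hf; elim: k => [|k IH] //=; apply: Cdiff_div. Qed.

Lemma Csub0 (z : C) : (z - 0)%C = z. Proof. ring. Qed.

Lemma pole_bound f c k z r B : 0 < r -> r <= Cmod (z - c) -> Cmod (f z) <= B ->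
  Cmod (pole f c k z) <= B / r ^ k.
Proof.
move=> hr hz hB; elim: k => [|k IH] /=; first by lra.
have nz : (z - c)%C <> 0%C by apply/Cmod_gt_0; lra.
rewrite Csub0 Cmod_div //.
have hp := pow_lt r k hr.
have -> : B / (r * r ^ k) = B / r ^ k / r by field; lra.
apply: Rmult_le_compat => //; first exact: Cmod_ge_0.
  by apply: Rlt_le; apply: Rinv_0_lt_compat; lra.
exact: Rinv_le_contravar.
Qed.

Lemma square_edge_in c r z : 0 < r -> square_edge c r z -> in_square c r z.
Proof. by move=> hr; apply: edge_in_rect; lra. Qed.

Lemma square_edge_neq_center c r z : 0 < r -> square_edge c r z -> z <> c.
Proof.
move=> hr /(square_edge_far hr) h e; move: h.
by rewrite e (_ : (c - c)%C = 0%C) ?Cmod_0; [lra|ring].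
Qed.

Section LocalApprox.
Variables (c : C) (r : R) (f : C -> C) (B : R).
Hypothesis hr : 0 < r.
Hypothesis hf : forall z, in_square c r z -> Cdifferentiable_at f z.
Hypothesis hB : forall z, in_square c r z -> Cmod (f z) <= B.

Lemma pole_diff_edge k z : square_edge c r z -> Cdifferentiable_at (pole f c k) z.
Proof.
move=> hz; apply: pole_diff; first exact: square_edge_neq_center hz.
by apply: hf; apply: square_edge_in.
Qed.

(** [goursat_removable] is applied at [l], with the difference quotient split on the edge into a
    multiple of the kernel and the desired integrand. *)
Lemma cauchy_square l : Cmod (l - c) <= r / 16 ->
  square_int c r (fun s => (f s - 0) / (s - l))%C = (f l * winding c r l)%C.
Proof.
move=> hl; have [n1 n2] := near_center hl.
move/Rabs_le_between: n1 => n1; move/Rabs_le_between: n2 => n2.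
have := @goursat_removable f (fst c - r) (fst c + r) (snd c - r) (snd c + r) (fst l) (snd l).
rewrite -surjective_pairing => H.
have {}H := H _ _ hf.
have hx : fst c - r <= fst c + r by lra.
have hy : snd c - r <= snd c + r by lra.
rewrite (@rect_int_ext _ _ _ _ hx hy _ (fun s => - f l * ckernel l s + (f s - 0) / (s - l))%C) in H; last first.
  move=> s hs; have := Csub_neq0 (square_edge_neq hr hl hs) => nz.
  by rewrite /ckernel; field.
rewrite rect_int_lin // in H; last 2 first.
- by move=> z hz; apply: ckernel_cont hz.
- move=> z hz; apply: Cdiff_cont; apply: Cdiff_div; first exact: square_edge_neq hz.
  by apply: hf; apply: square_edge_in.
rewrite -/(square_int c r (ckernel l)) -/(winding c r l) in H.
have {}H : (- f l * winding c r l + square_int c r (fun s => (f s - 0) / (s - l)))%C = 0%C.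
  by apply: H; lra.
rewrite -[LHS](_ : (f l * winding c r l + (- f l * winding c r l + square_int c r (fun s => (f s - 0) / (s - l))))%C = _); last by ring.
by rewrite H; ring.
Qed.

(** The geometric series of the Cauchy kernel, one term at a time: [/ (s - l) = / (s - c) + (l - c)
    / ((s - c) * (s - l))], integrated against [f]. *)
Lemma cauchy_expansion l d : Cmod (l - c) <= r / 16 ->
  (f l * winding c r l)%C = Cplus
   (\big[Cadd/C0]_(k < d) Cmult (Cpow (l - c) k) (square_int c r (pole f c k.+1)))
   (Cmult (Cpow (l - c) d) (square_int c r (fun s => (pole f c d s - 0) / (s - l))%C)).
Proof.
move=> hl; rewrite -cauchy_square //.
have hx : fst c - r <= fst c + r by lra.
have hy : snd c - r <= snd c + r by lra.
elim: d => [|d IH]; first by rewrite big_ord0 /=; apply: injective_projections => /=; ring.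
rewrite IH big_ord_recr.
set S := bigop _ _ _.
change (Cplus S (Cmult (Cpow (l - c) d) (square_int c r (fun s => (pole f c d s - 0) / (s - l))%C)) =
  Cplus (Cplus S (Cmult (Cpow (l - c) d) (square_int c r (pole f c d.+1))))
    (Cmult (Cpow (l - c) d.+1) (square_int c r (fun s => (pole f c d.+1 s - 0) / (s - l))%C))).
have -> : square_int c r (fun s => (pole f c d s - 0) / (s - l))%C
  = ((l - c) * square_int c r (fun s => (pole f c d.+1 s - 0) / (s - l))
      + square_int c r (pole f c d.+1))%C.
  rewrite -rect_int_lin //; last 2 first.
  - move=> z hz; apply: Cdiff_cont; apply: Cdiff_div; first exact: square_edge_neq hz.
    exact: pole_diff_edge.
  - by move=> z hz; apply: Cdiff_cont; apply: pole_diff_edge.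
  apply: rect_int_ext => // s hs /=.
  have n1 := Csub_neq0 (square_edge_neq hr hl hs).
  have n2 := Csub_neq0 (square_edge_neq_center hr hs).
  by field; split.
rewrite [Cpow _ d.+1]/=; Cring.
Qed.

(** The remainder carries the ratio of [Cmod (l - c) <= r / 16] to the distance of the edge from
    [c], at least [r], to the power [d]. The contour estimate contributes 32 and division by the
    winding integral 2; the constant 128 leaves a margin. *)
Lemma local_approx_aux l d : Cmod (l - c) <= r / 16 ->
  Cmod (f l - \big[Cadd/C0]_(k < d) Cmult (Cpow (l - c) k / winding c r l)
      (square_int c r (pole f c k.+1))) <= 128 * B * (/ 16) ^ d.
Proof.
move=> hl.
have hx : fst c - r <= fst c + r by lra.
have hy : snd c - r <= snd c + r by lra.
have W := winding_lower hr hl.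
have nW : winding c r l <> 0%C by apply/Cmod_gt_0; lra.
have -> : \big[Cadd/C0]_(k < d) Cmult (Cpow (l - c) k / winding c r l) (square_int c r (pole f c k.+1))
  = Cmult (/ winding c r l) (\big[Cadd/C0]_(k < d) Cmult (Cpow (l - c) k) (square_int c r (pole f c k.+1))).
  apply: (big_rec2 (fun x y => x = Cmult (/ winding c r l) y)).
    by apply: injective_projections => /=; ring.
  move=> i x y _ ->; change (Cadd ?x ?y) with (Cplus x y); rewrite /Cdiv; Cring.
have E := cauchy_expansion d hl.
set S := bigop _ _ _ in E *.
set I := square_int c r (fun s => _) in E.
rewrite (_ : (f l - / winding c r l * S)%C = (Cpow (l - c) d * I / winding c r l)%C); last first.
  have -> : f l = (f l * winding c r l / winding c r l)%C by field.
  by rewrite E; field.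
have B0 : 0 <= B.
  apply: Rle_trans (Cmod_ge_0 (f c)) (hB _); split; lra.
have hI : Cmod I <= 4 * (B / r ^ d / (r / 2)) * ((fst c + r - (fst c - r)) + (snd c + r - (snd c - r))).
  apply: rect_int_bound => // z hz.
    apply: Cdiff_cont; apply: Cdiff_div; first exact: square_edge_neq hz.
    exact: pole_diff_edge.
  have far := square_edge_far_l hr hl hz.
  have nz := Csub_neq0 (square_edge_neq hr hl hz).
  rewrite Csub0 Cmod_div //.
  apply: Rmult_le_compat; first exact: Cmod_ge_0.
  - by apply: Rlt_le; apply: Rinv_0_lt_compat; lra.
  - apply: pole_bound => //; first exact: square_edge_far.
    by apply: hB; apply: square_edge_in.
  - by apply: Rinv_le_contravar; lra.
have hp := pow_lt r d hr.
have {}hI : Cmod I <= 32 * B / r ^ d * 1.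
  apply: Rle_trans hI _; apply: Req_le; field; lra.
rewrite Cmod_div // Cmod_mult Cmod_pow.
have h1 : Cmod (l - c) ^ d <= (r / 16) ^ d by apply: pow_incr; split => //; apply: Cmod_ge_0.
have h2 : / Cmod (winding c r l) <= 2.
  by rewrite -(Rinv_inv 2); apply: Rinv_le_contravar; lra.
have h3 : Cmod (l - c) ^ d * Cmod I <= 32 * B * (/ 16) ^ d.
  have -> : 32 * B * (/ 16) ^ d = (r / 16) ^ d * (32 * B / r ^ d * 1).
    by rewrite /Rdiv (Rpow_mult_distr r); field; lra.
  apply: Rmult_le_compat => //; last exact: Cmod_ge_0.
  by apply: pow_le; apply: Cmod_ge_0.
have h4 : 0 <= 32 * B * (/ 16) ^ d.
  by apply: Rmult_le_pos; [lra|apply: pow_le; lra].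
apply: Rle_trans (_ : 32 * B * (/ 16) ^ d * 2 <= _); last by lra.
apply: Rmult_le_compat => //.
- by apply: Rmult_le_pos; [apply: pow_le; apply: Cmod_ge_0|apply: Cmod_ge_0].
- by apply: Rlt_le; apply: Rinv_0_lt_compat; lra.
Qed.

End LocalApprox.

(* The same [e] serves every [f]: only the coefficients [a] depend on [f]. *)
Lemma local_approx (c : C) r d : 0 < r -> exists e : nat -> Cx -> Cx, forall f B,
  (forall z, in_square c r z -> Cdifferentiable_at f z) ->
  (forall z, in_square c r z -> Cmod (f z) <= B) ->
  exists a : nat -> Cx, forall l, Cmod (l - c) <= r / 16 ->
    Cmod (f l - \big[Cadd/C0]_(k < d) Cmul (e k l) (a k)) <= 128 * B * (/ 16) ^ d.
Proof.
move=> hr; exists (fun k l => Cpow (l - c) k / winding c r l)%C => f B hf hB.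
exists (fun k => square_int c r (pole f c k.+1)) => l hl.
exact: local_approx_aux.
Qed.

(** * Cross approximation *)

(* An alias keeps this field structure apart from the componentwise one on products. *)
Definition CC : Type := Cx.

HB.instance Definition _ := gen_eqMixin CC.
HB.instance Definition _ := gen_choiceMixin CC.

Lemma CaddN : left_inverse C0 (Copp : CC -> CC) Cadd.
Proof. by move=> x; apply: injective_projections => /=; ring. Qed.

HB.instance Definition _ := GRing.isZmodule.Build CC CaddA CaddC Cadd0 CaddN.

Lemma CmulA : associative (Cmul : CC -> CC -> CC).
Proof. by move=> x y z; apply: injective_projections => /=; ring. Qed.
Lemma CmulC : commutative (Cmul : CC -> CC -> CC).
Proof. by move=> x y; apply: injective_projections => /=; ring. Qed.
Lemma Cmul1 : left_id (Defs.C1 : CC) Cmul.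
Proof. by move=> x; apply: injective_projections => /=; ring. Qed.
Lemma CmulDl : left_distributive (Cmul : CC -> CC -> CC) Cadd.
Proof. by move=> x y z; apply: injective_projections => /=; ring. Qed.
Lemma C1_neq0 : (Defs.C1 : CC) != (0 : CC)%R.
Proof. by apply/eqP => /(congr1 fst) /= h; lra. Qed.

HB.instance Definition _ :=
  GRing.Zmodule_isComNzRing.Build CC CmulA CmulC Cmul1 CmulDl C1_neq0.

Lemma CmulVf (x : CC) : x != 0%R -> ((Cinv x : CC) * x)%R = 1%R.
Proof.
move=> /eqP nx; apply: etrans (Cinv_l x _); first by [].
by move=> e; apply: nx.
Qed.

Lemma Cinv0 : (Cinv (0%R : CC) : CC) = 0%R.
Proof. by apply: injective_projections => /=; rewrite /Rdiv; ring. Qed.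

HB.instance Definition _ := GRing.ComNzRing_isField.Build CC CmulVf Cinv0.

Definition nrm (z : CC) : R := Cmod z.

Lemma nrm_ge0 z : 0 <= nrm z. Proof. exact: Cmod_ge_0. Qed.
Lemma nrm0 : nrm 0%R = 0. Proof. exact: Cmod_0. Qed.
Lemma nrm1 : nrm 1%R = 1. Proof. exact: Cmod_1. Qed.
Lemma nrmN z : nrm (- z)%R = nrm z. Proof. exact: Cmod_opp. Qed.
Lemma nrmD x y : nrm (x + y)%R <= nrm x + nrm y. Proof. exact: Cmod_triangle. Qed.
Lemma nrmB x y : nrm (x - y)%R <= nrm x + nrm y.
Proof. by rewrite -(nrmN y); apply: nrmD. Qed.
Lemma nrmM x y : nrm (x * y)%R = nrm x * nrm y. Proof. exact: Cmod_mult. Qed.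
Lemma nrm_gt0 x : x <> 0%R <-> 0 < nrm x. Proof. exact: Cmod_gt_0. Qed.
Lemma nrm_dist (x y z : CC) : nrm (x - z)%R <= nrm (x - y)%R + nrm (y - z)%R.
Proof. exact: Cmod_sub_le. Qed.
Lemma nrmV (x : CC) : x <> 0%R -> nrm (x^-1)%R = / nrm x.
Proof. exact: Cmod_inv. Qed.

Lemma nrm_sign n : nrm ((-1) ^+ n)%R = 1.
Proof. by elim: n => [|n IH]; rewrite ?expr0 ?nrm1 // exprS nrmM IH nrmN nrm1; lra. Qed.

Lemma nrm_sum_seq (I : Type) (r : seq I) (f : I -> CC) M :
  (forall i, nrm (f i) <= M) -> nrm (\sum_(i <- r) f i)%R <= INR (size r) * M.
Proof.
move=> hM; elim: r => [|i r IH]; first by rewrite big_nil nrm0 /=; lra.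
rewrite big_cons [size _]/= S_INR Rmult_plus_distr_r Rmult_1_l Rplus_comm.
by apply: Rle_trans (nrmD _ _) _; apply: Rplus_le_compat.
Qed.

Lemma nrm_sum (T : finType) (f : T -> CC) M :
  (forall i, nrm (f i) <= M) -> nrm (\sum_i f i)%R <= INR #|T| * M.
Proof. by move=> hM; rewrite -big_enum cardE; exact: nrm_sum_seq. Qed.

Lemma nrm_prod_seq (I : Type) (r : seq I) (f : I -> CC) M : 0 <= M ->
  (forall i, nrm (f i) <= M) -> nrm (\prod_(i <- r) f i)%R <= M ^ size r.
Proof.
move=> M0 hM; elim: r => [|i r IH]; first by rewrite big_nil nrm1 /=; lra.
rewrite big_cons nrmM /=; apply: Rmult_le_compat => //; exact: nrm_ge0.
Qed.

Lemma nrm_prod (T : finType) (f : T -> CC) M : 0 <= M ->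
  (forall i, nrm (f i) <= M) -> nrm (\prod_i f i)%R <= M ^ #|T|.
Proof. by move=> M0 hM; rewrite -big_enum cardE; exact: nrm_prod_seq. Qed.

Lemma fin_argmax (T : finType) (f : T -> R) (i0 : T) : exists i, forall j, f j <= f i.
Proof.
have H (s : seq T) : exists i, forall j, j \in i0 :: s -> f j <= f i.
  elim: s => [|k s [i hi]].
    by exists i0 => j; rewrite inE => /eqP ->; lra.
  case: (Rle_lt_dec (f k) (f i)) => h; [exists i|exists k] => j;
    rewrite !inE => /orP [/eqP -> | /orP [/eqP ->|hj]]; try lra.
  - by apply: hi; rewrite inE eqxx.
  - by apply: hi; rewrite inE hj orbT.
  - by apply: Rle_trans (Rlt_le _ _ h); apply: hi; rewrite inE eqxx.
  - by apply: Rle_trans (Rlt_le _ _ h); apply: hi; rewrite inE hj orbT.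
have [i hi] := H (enum T); exists i => j; apply: hi.
by rewrite inE mem_enum orbT.
Qed.

Lemma fin_bound (T : finType) (f : T -> R) : exists M, 0 <= M /\ forall i, f i <= M.
Proof.
case: (pickP (fun _ : T => true)) => [i0 _|h].
  have [i hi] := fin_argmax f i0; exists (Rmax 0 (f i)); split; first exact: Rmax_l.
  by move=> j; apply: Rle_trans (hi j) (Rmax_r _ _).
by exists 0; split; [lra|move=> i; have := h i].
Qed.

(** Sample points range over arbitrary types, where a supremum need not be attained; a value within
    a factor 2 of it replaces the maximum. *)
Lemma sup_half (T : Type) (f : T -> R) M (t0 : T) :
  (forall t, f t <= M) -> 0 < f t0 -> exists t, 0 < f t /\ forall t', f t' <= 2 * f t.
Proof.
move=> hM h0.
have [||S [h1 h2]] := completeness (fun y => exists t, y = f t).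
- by exists M => y [t ->].
- by exists (f t0), t0.
have hS : f t0 <= S by apply: h1; exists t0.
case: (classic (exists t, S / 2 < f t)) => [[t ht]|n].
  exists t; split; first by lra.
  by move=> t'; have : f t' <= S by [apply: h1; exists t'|]; lra.
suff : S <= S / 2 by lra.
by apply: h2 => y [t ->]; apply: Rnot_lt_le => h; apply: n; exists t.
Qed.

Lemma bound_ge0 r eta : 0 <= eta -> 0 <= 2 * INR r.+1 ^ 2 * eta.
Proof.
move=> h; apply: Rmult_le_pos h; apply: Rmult_le_pos; first by lra.
exact: pow_le (pos_INR _).
Qed.

Section CrossApproximation.
Variables (L X : Type) (g : L -> X -> CC) (G : R).
Hypothesis hG : forall l x, nrm (g l x) <= G.

Definition sample s (u : 'I_s -> L) (v : 'I_s -> X) : 'M[CC]_s :=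
  (\matrix_(i, j) g (u i) (v j))%R.

Lemma sample_det_bounded s : exists M, forall u v, nrm (\det (sample (s := s) u v))%R <= M.
Proof.
exists (INR #|{: {perm 'I_s}}| * (1 * (Rmax 0 G) ^ #|'I_s|)) => u v.
rewrite /determinant; apply: nrm_sum => p; rewrite nrmM nrm_sign !Rmult_1_l.
apply: nrm_prod => [|i]; first exact: Rmax_l.
by rewrite mxE; apply: Rle_trans (hG _ _) (Rmax_r _ _).
Qed.

(** The index type ['I_(1 + s)] makes the sample at the extended points a [block_mx]. *)
Definition extend (T : Type) s (t : T) (u : 'I_s -> T) (i : 'I_(1 + s)) : T :=
  match split i with inl _ => t | inr k => u k end.

(** The error of the cross approximation, and also the Schur complement of [sample u v] in the
    sample extended by [l] and [x]. *)
Definition residual s (u : 'I_s -> L) (v : 'I_s -> X) l x : CC :=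
  (g l x - \sum_j (\sum_k g l (v k) * invmx (sample u v) k j) * g (u j) x)%R.

(** Schur's determinant formula: block elimination by a unipotent matrix leaves a block triangular
    one whose corner is the residual. *)
Lemma sample_extend_det s u v l x : sample (s := s) u v \in unitmx ->
  (\det (sample (extend l u) (extend x v)) = residual u v l x * \det (sample u v))%R.
Proof.
move=> uA; set A := sample u v in uA *.
pose d : 'M[CC]_1 := (\matrix_(i, j) g l x)%R.
pose c : 'M[CC]_(1, s) := (\matrix_(i, j) g l (v j))%R.
pose b : 'M[CC]_(s, 1) := (\matrix_(i, j) g (u i) x)%R.
have -> : sample (extend l u) (extend x v) = block_mx d c b A.
  apply/matrixP => i j; rewrite /block_mx !mxE /extend.
  by case: (split i) => i'; rewrite !mxE; case: (split j) => j'; rewrite !mxE.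
have E : (block_mx d c b A *m block_mx 1%:M 0 (- (invmx A *m b)) 1%:M
    = block_mx (d - c *m invmx A *m b) c 0 A)%R.
  rewrite mulmx_block !mulmx1 !mulmx0 !mulmxN !add0r mulmxA.
  by rewrite mulmxA mulmxV // mul1mx subrr.
have := congr1 determinant E.
rewrite det_mulmx det_lblock !det1 !mulr1 det_ublock det_mx11 => ->.
congr (_ * _)%R; rewrite !mxE /residual; congr (_ - _)%R.
by apply: eq_bigr => j _; rewrite !mxE; congr (_ * _)%R; apply: eq_bigr => k _; rewrite !mxE.
Qed.

(** Brings the cofactors of a sample under the near-maximality hypothesis. *)
Lemma sample_minor s (u : 'I_s.+1 -> L) (v : 'I_s.+1 -> X) i j :
  row' i (col' j (sample u v)) = sample (fun k => u (lift i k)) (fun k => v (lift j k)).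
Proof. by apply/matrixP => a b; rewrite !mxE. Qed.

Variables (r : nat) (e : 'I_r -> L -> CC) (a : 'I_r -> X -> CC) (eta : R).
Hypothesis heta : 0 <= eta.
Hypothesis happ : forall l x, nrm (g l x - \sum_k e k l * a k x)%R <= eta.

(* A matrix within [eta] of rank at most [r] has an inverse with some entry at least
   [1 / ((r+1)^2 eta)]; near-maximality of the minor bounds all these entries by
   [2 / |residual|]. *)
Lemma residual_bound (u : 'I_r -> L) (v : 'I_r -> X) l x :
  0 < nrm (\det (sample u v))%R ->
  (forall u' v', nrm (\det (sample (s := r) u' v'))%R <= 2 * nrm (\det (sample u v))%R) ->
  nrm (residual u v l x) <= 2 * INR r.+1 ^ 2 * eta.
Proof.
move=> hdet hmax.
case: (classic (residual u v l x = 0%R)) => [->|nres].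
  by rewrite nrm0; apply: bound_ge0.
have hres : 0 < nrm (residual u v l x) by apply/nrm_gt0.
set rho := nrm _ in hres *.
set D := nrm _ in hdet hmax.
have uA : sample u v \in unitmx.
  by rewrite unitmxE unitfE; apply/eqP => h0; move: hdet; rewrite /D h0 nrm0; lra.
have dM := sample_extend_det l x uA.
set M : 'M[CC]_r.+1 := sample (extend l u) (extend x v) in dM.
have nM : nrm (\det M)%R = rho * D by rewrite dM nrmM.
have pM : 0 < nrm (\det M)%R by rewrite nM; nra.
have uM : M \in unitmx.
  by rewrite unitmxE unitfE; apply/eqP => h0; move: pM; rewrite h0 nrm0; lra.
(* Cramer's rule: the cofactor is, up to sign, a sample determinant of size [r], at most [2 * D] in
   norm, and [\det M] has norm [rho * D]. *)
have hinv i j : nrm (invmx M i j) <= 2 / rho.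
  rewrite /invmx uM mxE nrmM nrmV; last by apply/nrm_gt0.
  rewrite mxE /cofactor nrmM nrm_sign Rmult_1_l sample_minor nM.
  have -> : 2 / rho = / (rho * D) * (2 * D) by field; lra.
  by apply: Rmult_le_compat_l; [apply: Rlt_le; apply: Rinv_0_lt_compat; nra|apply: hmax].
pose E : 'M[CC]_(r.+1, r) := (\matrix_(i, k) e k (extend l u i))%R.
pose F : 'M[CC]_(r, r.+1) := (\matrix_(k, j) a k (extend x v j))%R.
(* A product through dimension [r] has rank below [r.+1], hence a nonzero left kernel vector. *)
have : (kermx (E *m F) != 0)%R.
  rewrite kermx_eq0; apply/negP => /eqP h.
  have : (\rank (E *m F)%R <= r)%N by apply: leq_trans (mxrankM_maxl _ _) (rank_leq_col _).
  by rewrite h ltnn.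
case/rowV0Pn => w /sub_kermxP hw nw.
have [j0 hj0] := fin_argmax (fun j => nrm (w 0%R j)) ord0.
set m := nrm (w 0%R j0) in hj0.
have hm : 0 < m.
  case: (Rle_lt_dec m 0) => // h; case/eqP: nw; apply/matrixP => i j; rewrite mxE (ord1 i).
  by apply: NNPP => /nrm_gt0 hh; apply: (Rlt_not_le _ _ hh); apply: Rle_trans (hj0 j) h.
(* As [w] annihilates [E *m F], it is reproduced by [M - E *m F] followed by [invmx M]. At the entry
   of largest norm [m] this yields an inequality from which [m] cancels. *)
have ew : (w = (w *m (M - E *m F)) *m invmx M)%R.
  by rewrite mulmxBr hw subr0 mulmxK.
have hw1 j : nrm ((w *m (M - E *m F)) 0 j)%R <= INR r.+1 * (m * eta).
  rewrite mxE -[X in INR X](card_ord r.+1); apply: nrm_sum => k; rewrite nrmM.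
  apply: Rmult_le_compat; [exact: nrm_ge0|exact: nrm_ge0|exact: hj0|].
  rewrite !mxE; under eq_bigr => i _ do rewrite !mxE.
  exact: happ.
have : m <= INR r.+1 * (INR r.+1 * (m * eta) * (2 / rho)).
  rewrite {1}/m ew mxE -[X in INR X](card_ord r.+1); apply: nrm_sum => k; rewrite nrmM card_ord.
  by apply: Rmult_le_compat; [exact: nrm_ge0|exact: nrm_ge0|exact: hw1|exact: hinv].
set N := INR r.+1 => hfin.
have : m * rho <= m * (2 * N ^ 2 * eta).
  have -> : m * (2 * N ^ 2 * eta) = N * (N * (m * eta) * (2 / rho)) * rho by field; lra.
  by apply: Rmult_le_compat_r; lra.
by move/Rmult_le_reg_l; apply.
Qed.

(** If some sample of size [r] is nonsingular, a nearly maximal one works by [residual_bound].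
    Otherwise a nonsingular size [s] is taken with none at [s.+1]: all the larger determinants
    vanish, and with them the residual. *)
Lemma cross_approx : exists s (u : 'I_s -> L) (v : 'I_s -> X) (c : 'M[CC]_s), forall l x,
  nrm (g l x - \sum_j (\sum_k g l (v k) * c k j) * g (u j) x)%R <= 2 * INR r.+1 ^ 2 * eta.
Proof.
pose nz s := exists p : ('I_s -> L) * ('I_s -> X), 0 < nrm (\det (sample p.1 p.2))%R.
(* The empty determinant is 1, so the search has a starting point even if [L] or [X] is empty. *)
have nz0 : nz 0%N.
  have f T : 'I_0 -> T by case.
  by exists (f L, f X); rewrite det_mx00 nrm1; lra.
have [s [hs hs2]] : exists s, nz s /\ (s = r \/ ~ nz s.+1).
  suff [s [_ [h1 h2]]] : exists s, (s <= r)%N /\ nz s /\ (s = r \/ ~ nz s.+1) by exists s.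
  elim: (r) => [|q [s [hq [h1 h2]]]]; first by exists 0%N; split=> //; split => //; left.
  case: (classic (nz q.+1)) => h3; first by exists q.+1; split=> //; split => //; left.
  exists s; split; first exact: leqW.
  by split => //; right; case: h2 => [->|].
have [p0 hp0] := hs; have [B hB] := sample_det_bounded s.
have [[u v] /= [h1 h2]] := sup_half (f := fun p : ('I_s -> L) * ('I_s -> X) =>
  nrm (\det (sample p.1 p.2))%R) (fun p => hB p.1 p.2) hp0.
exists s, u, v, (invmx (sample u v)) => l x.
have {}h2 u' v' : nrm (\det (sample (s := s) u' v'))%R <= 2 * nrm (\det (sample u v))%R.
  exact: (h2 (u', v')).
rewrite -/(residual u v l x).
case: hs2 => [es|nzs]; first by subst s; apply: residual_bound.
have uA : sample u v \in unitmx.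
  by rewrite unitmxE unitfE; apply/eqP => h0; move: h1; rewrite h0 nrm0; lra.
have := sample_extend_det l x uA; set M := (\det _)%R => hM.
have M0 : M = 0%R.
  by apply: NNPP => /nrm_gt0 n; apply: nzs; exists (extend l u, extend x v).
have -> : residual u v l x = 0%R.
  move: hM; rewrite M0 => /esym/eqP; rewrite mulf_eq0 => /orP [/eqP -> //|/eqP h].
  by move: h1; rewrite h nrm0; lra.
by rewrite nrm0; apply: bound_ge0.
Qed.

End CrossApproximation.

(** * Compactness *)

Lemma list_min (A : Type) (l : list A) (f : A -> R) (P : A -> Prop) :
  (forall c, P c -> 0 < f c) -> exists d, 0 < d /\ forall c, In c l -> P c -> d <= f c.
Proof.
move=> hf; elim: l => [|c l [d [hd h]]]; first by exists 1; split; [lra|].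
case: (classic (P c)) => hc.
  exists (Rmin d (f c)); split; first by apply: Rmin_pos => //; apply: hf.
  by move=> c' [<- _|i p]; [apply: Rmin_r|apply: Rle_trans (Rmin_l _ _) (h _ i p)].
by exists d; split => // c' [<- //|]; apply: h.
Qed.

Lemma list_max (A : Type) (l : list A) (f : A -> R) : exists M, forall c, In c l -> f c <= M.
Proof.
elim: l => [|c l [M h]]; first by exists 0.
exists (Rmax M (f c)) => c' [<-|i]; first exact: Rmax_r.
exact: Rle_trans (h _ i) (Rmax_l _ _).
Qed.

Lemma compact_balls (K : Cx -> Prop) (r : Cx -> R) : Ccompact K ->
  (forall c, K c -> 0 < r c) ->
  exists l : list Cx, forall z, K z -> exists c, [/\ In c l, K c & Cmod (z - c) < r c].
Proof.
move=> hK hr.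
have [||l hl] := hK Cx (fun c w => K c /\ Cmod (w - c) < r c).
- move=> c z [kc hz]; exists (r c - Cmod (z - c)); split; first by lra.
  move=> w; change (Cnorm (Csub w z)) with (Cmod (w - z)) => hw; split => //.
  by have := Cmod_sub_le w z c; lra.
- move=> z kz; exists z; split => //.
  by rewrite (_ : (z - z)%C = 0%C) ?Cmod_0; [apply: hr|ring].
by exists l => z /hl [c [i [k h]]]; exists c.
Qed.

Definition nbhd_of (K : Cx -> Prop) d (z : Cx) : Prop := exists y, K y /\ Cmod (z - y) < d.

Lemma nbhd_of_self (K : Cx -> Prop) d z : 0 < d -> K z -> nbhd_of K d z.
Proof.
by move=> hd kz; exists z; split => //; rewrite (_ : (z - z)%C = 0%C) ?Cmod_0 //; ring.
Qed.

Lemma nbhd_of_le (K : Cx -> Prop) d d' z : d <= d' -> nbhd_of K d z -> nbhd_of K d' z.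
Proof. by move=> h [y [ky hy]]; exists y; split => //; lra. Qed.

Section Product.
Variables (T : finType) (K : T -> Cx -> Prop).
Hypothesis hK : forall i, Ccompact (K i).

Definition upd (x : T -> Cx) i w : T -> Cx := fun j => if j == i then w else x j.

Lemma upd_in x i w : (forall j, K j (x j)) -> K i w -> forall j, K j (upd x i w j).
Proof. by move=> hx hw j; rewrite /upd; case: eqP => [->|]. Qed.

(** A tube-lemma induction: [H] releases the coordinates in [s] one by one, from a ball around [x i]
    to a neighborhood of all of [K i], using finitely many balls, the least radius and the greatest
    bound. *)
Lemma local_to_uniform (Q : R -> (T -> Cx) -> Prop) :
  (forall B B' x, B <= B' -> Q B x -> Q B' x) ->
  (forall x, (forall i, K i (x i)) -> exists d B, 0 < d /\
     forall x', (forall i, Cmod (x' i - x i) < d) -> Q B x') ->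
  exists d B, 0 < d /\ forall x, (forall i, nbhd_of (K i) d (x i)) -> Q B x.
Proof.
move=> hmono hloc.
case: (classic (exists x, forall i, K i (x i))) => [[x hx]|nx]; last first.
  (* By choice, an empty product means that some [K i] is empty, and then its neighborhood is empty
     too. *)
  have [i hi] : exists i, forall z, ~ K i z.
    apply: NNPP => n; apply: nx.
    have /choice [x hx] : forall i, exists z, K i z.
      by move=> i; apply: NNPP => n2; apply: n; exists i => z hz; apply: n2; exists z.
    by exists x.
  by exists 1, 0; split; [lra|move=> x /(_ i) [y [/hi []]]].
suff H (s : list T) : forall x, (forall i, K i (x i)) -> exists d B, 0 < d /\ forall x',
    (forall i, if i \in s then nbhd_of (K i) d (x' i) else Cmod (x' i - x i) < d) -> Q B x'.
  have [d [B [hd h]]] := H (enum T) x hx.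
  by exists d, B; split => // x' hx'; apply: h => i; rewrite mem_enum /=; apply: hx'.
elim: s => [|i s IH] {}x {}hx.
  by have [d [B [hd h]]] := hloc x hx; exists d, B; split.
have /choice [p hp] : forall c, exists p : R * R, K i c -> 0 < p.1 /\ forall x',
    (forall j, if j \in s then nbhd_of (K j) p.1 (x' j) else Cmod (x' j - upd x i c j) < p.1) -> Q p.2 x'.
  move=> c; case: (classic (K i c)) => kc; last by exists (0, 0).
  have [d [B [hd h]]] := IH (upd x i c) (upd_in hx kc).
  by exists (d, B).
(* Half of each radius goes to the cover, the other half to the neighborhood of [K i]. *)
have [|l hl] := compact_balls (r := fun c => (p c).1 / 2) (hK (i := i)).
  by move=> c /hp [h _]; lra.
have [|d [hd hdl]] := list_min l (f := fun c => (p c).1 / 2) (P := K i).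
  by move=> c /hp [h _]; lra.
have [B hB] := list_max l (fun c => (p c).2).
exists d, B; split => // x' hx'.
have [y [ky hy]] : nbhd_of (K i) d (x' i) by have := hx' i; rewrite inE eqxx.
have [c [il kc hc]] := hl y ky.
have dc := hdl c il kc; have [p0 hQ] := hp c kc.
apply: hmono (hB c il) _; apply: hQ => j.
have := hx' j; rewrite inE /upd; case: (eqVneq j i) => [->|nj] /=; last first.
  by case: (j \in s) => h; [apply: nbhd_of_le h; lra|lra].
case: (i \in s) => h; first by apply: nbhd_of_le h; lra.
by have := Cmod_sub_le (x' i) y c; lra.
Qed.

End Product.

(** * Uniform approximation of low rank on a compact set *)

Lemma INR_le_pow2 d : INR d.+1 * (/ 2) ^ d <= 1.
Proof.
elim: d => [|d IH]; first by rewrite /=; lra.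
rewrite [X in _ * X]/= S_INR.
have h := half_pow_pos d; have : 1 <= INR d.+1 by rewrite S_INR; have := pos_INR d; lra.
nra.
Qed.

(** With [t = (/ 2) ^ d] the error is [t ^ 4] up to constants. Two factors [t] absorb the squared
    rank, as [INR (m * d).+1 * t <= INR m + 1]; of the other two, one is enough to get below
    [eps]. *)
Lemma rank_error_small m B eps : 0 <= B -> 0 < eps ->
  exists d, 2 * INR (m * d).+1 ^ 2 * (128 * B * (/ 16) ^ d) <= eps.
Proof.
move=> hB he; have hm := pos_INR m.
pose A := 256 * (INR m + 1) ^ 2 * (B + 1).
have hA : 0 < A.
  by apply: Rmult_lt_0_compat; [apply: Rmult_lt_0_compat; [lra|apply: pow_lt; lra]|lra].
have [d hd] := half_pow_lt (Rdiv_lt_0_compat _ _ he hA).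
exists d; set t := (/ 2) ^ d in hd; have ht : 0 < t := half_pow_pos d.
have -> : (/ 16) ^ d = t ^ 4.
  rewrite /t -pow_mult Nat.mul_comm pow_mult; congr pow; field.
have t1 : t <= 1.
  have := INR_le_pow2 d; rewrite -/t S_INR; have := pos_INR d; nra.
have hN : INR (m * d).+1 * t <= INR m + 1.
  have := INR_le_pow2 d; rewrite -/t !S_INR mult_INR; have := pos_INR d; nra.
set N := INR _ in hN *; have hN0 : 0 <= N by apply: pos_INR.
have -> : 2 * N ^ 2 * (128 * B * t ^ 4) = 256 * (N * t) ^ 2 * B * t ^ 2 by ring.
have h1 : (N * t) ^ 2 <= (INR m + 1) ^ 2 by apply: pow_incr; nra.
have h2 : 0 <= (N * t) ^ 2 by apply: pow_le; nra.
have h3 : t ^ 2 <= t by nra.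
have h4 : 256 * (N * t) ^ 2 * B <= A by rewrite /A; nra.
have h5 : A * t <= eps.
  have -> : eps = A * (eps / A) by field; lra.
  by apply: Rmult_le_compat_l; lra.
have h6 : 0 <= 256 * (N * t) ^ 2 * B by nra.
apply: Rle_trans h5; apply: Rmult_le_compat => //; nra.
Qed.

(** [J] assigns each point to one of finitely many squares, and [e] cuts the local functions off to
    the points so assigned. The resulting discontinuities are harmless: [cross_approx] uses only the
    number of terms and the error. *)
Lemma uniform_rank_approx (K : Cx -> Prop) d B eps : Ccompact K -> 0 < d -> 0 <= B -> 0 < eps ->
  exists r eta (e : 'I_r -> CC -> CC), [/\ 0 <= eta, 2 * INR r.+1 ^ 2 * eta <= eps &
    forall f, (forall z, nbhd_of K d z -> Cdifferentiable_at f z /\ Cmod (f z) <= B) ->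
    exists a : 'I_r -> CC, forall l, K l -> nrm ((f l : CC) - \sum_k e k l * a k)%R <= eta].
Proof.
move=> hK hd hB he.
(* A square of half-side [rho] lies within [2 * rho < d] of its center, so [f] is holomorphic and
   bounded there; [rho / 16] is the radius covered by [local_approx]. *)
pose rho := d / 4; have hrho : 0 < rho by rewrite /rho; lra.
have [|l hl] := compact_balls (r := fun _ => rho / 16) hK; first by move=> *; lra.
pose m := size l.
have /choice [J hJ] : forall z, exists j, K z -> exists lt : (j < m)%N,
   K (nth C0 l j) /\ Cmod (z - nth C0 l j) <= rho / 16.
  move=> z; case: (classic (K z)) => kz; last by exists 0%N.
  have [c [ic kc hc]] := hl z kz.
  have [j [jl ej]] := In_nth l c C0 ic.
  exists j => _; have lt : (j < m)%N by apply/ltP.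
  exists lt; have -> : nth C0 l j = c.
    by rewrite -ej; elim: (l) (j) => [|? ? IH] [].
  by split => //; lra.
have [D hD] := rank_error_small m hB he.
have /choice [e0 he0] := fun c => local_approx c D hrho.
pose P : finType := ('I_m * 'I_D)%type.
pose e (p : P) (z : CC) : CC := if J z == p.1 :> nat then e0 (nth C0 l p.1) p.2 z else (0 : CC)%R.
exists #|P|, (128 * B * (/ 16) ^ D), (fun k => e (enum_val k)); split.
- by apply: Rmult_le_pos; [lra|apply: pow_le; lra].
- by rewrite card_prod !card_ord.
move=> f hf.
have /choice [a0 ha0] : forall c, exists a : nat -> Cx, K c -> forall z, Cmod (z - c) <= rho / 16 ->
    Cmod (f z - \big[Cadd/C0]_(k < D) Cmul (e0 c k z) (a k)) <= 128 * B * (/ 16) ^ D.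
  move=> c; case: (classic (K c)) => kc; last by exists (fun _ => C0).
  have inn z : in_square c rho z -> nbhd_of K d z.
    move=> [z1 z2]; exists c; split => //; apply: Rle_lt_trans (Cmod_le_abs _) _ => /=.
    have : Rabs (fst z + - fst c) <= rho by apply: Rabs_le; lra.
    have : Rabs (snd z + - snd c) <= rho by apply: Rabs_le; lra.
    rewrite /rho; lra.
  have [z /inn /hf []//|z /inn /hf []//|a ha] := he0 c f B.
  by exists a.
exists (fun k => a0 (nth C0 l (enum_val k : P).1) (enum_val k : P).2) => z kz.
have [lt [kc hz]] := hJ z kz.
rewrite -(big_enum_val (A := P) (fun p : P => e p z * (a0 (nth C0 l p.1) p.2 : CC))%R) /=.
rewrite -(pair_bigA _ (fun i j => e (i, j) z * (a0 (nth C0 l i) j : CC))%R) /=.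
rewrite (bigD1 (Ordinal lt)) //= [X in (_ - (_ + X))%R]big1 ?addr0; last first.
  move=> i ni; apply: big1 => j _; rewrite /e /=.
  case: eqP => [E|_]; last by rewrite mul0r.
  by case/eqP: ni; apply: val_inj.
rewrite (eq_bigr (fun j : 'I_D => (e0 (nth C0 l (J z)) j z : CC) * (a0 (nth C0 l (J z)) j : CC))%R).
  exact: ha0.
by move=> j _; rewrite /e /= eqxx.
Qed.

(** * Separation of variables *)

Lemma Cdiff_ext (f g : Cx -> Cx) z : (forall w, f w = g w) ->
  Cdifferentiable_at f z -> Cdifferentiable_at g z.
Proof. by move=> /funext ->. Qed.

Lemma Cdiff_lin (f g : CC -> CC) (c : CC) z : Cdifferentiable_at f z -> Cdifferentiable_at g z ->
  Cdifferentiable_at (fun w => f w * c + g w)%R z.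
Proof.
move=> [a ha] [b hb]; exists (Cplus (Cmult a c) b) => eps heps.
have hc := Cmod_ge_0 c.
have e1 : 0 < eps / (2 * (Cmod c + 1)) by apply: Rdiv_lt_0_compat; lra.
have e2 : 0 < eps / 2 by lra.
have [d1 [hd1 h1]] := ha _ e1.
have [d2 [hd2 h2]] := hb _ e2.
exists (Rmin d1 d2); split; first exact: Rmin_pos.
move=> w hw.
have {h1} : Cmod ((f w - f z) - a * (w - z)) <= eps / (2 * (Cmod c + 1)) * Cmod (w - z)
  := h1 w (Rlt_le_trans _ _ _ hw (Rmin_l _ _)).
have {h2} : Cmod ((g w - g z) - b * (w - z)) <= eps / 2 * Cmod (w - z)
  := h2 w (Rlt_le_trans _ _ _ hw (Rmin_r _ _)).
change (Cmod (g w - g z - b * (w - z)) <= eps / 2 * Cmod (w - z) ->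
  Cmod (f w - f z - a * (w - z)) <= eps / (2 * (Cmod c + 1)) * Cmod (w - z) ->
  Cmod ((f w * c + g w - (f z * c + g z)) - (a * c + b) * (w - z)) <= eps * Cmod (w - z)).
rewrite (_ : ((f w * c + g w - (f z * c + g z)) - (a * c + b) * (w - z)
  = (f w - f z - a * (w - z)) * c + (g w - g z - b * (w - z)))%C); last by ring.
move=> h2 h1; apply: Rle_trans (Cmod_triangle _ _) _; rewrite Cmod_mult.
have h5 : (Cmod c + 1) * Cmod (f w - f z - a * (w - z)) <= eps / 2 * Cmod (w - z).
  have -> : eps / 2 * Cmod (w - z) = (Cmod c + 1) * (eps / (2 * (Cmod c + 1)) * Cmod (w - z)).
    by field; lra.
  by apply: Rmult_le_compat_l => //; lra.
have := Cmod_ge_0 (f w - f z - a * (w - z)); nra.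
Qed.

Lemma Cdiff_sum (I : Type) (r : seq I) (f : I -> CC -> CC) (c : I -> CC) z :
  (forall i, Cdifferentiable_at (f i) z) ->
  Cdifferentiable_at (fun w => \sum_(i <- r) f i w * c i)%R z.
Proof.
move=> hf; elim: r => [|i r IH].
  by apply: (@Cdiff_ext (fun _ => C0)); [move=> w; rewrite big_nil|apply: Cdiff_const].
apply: (@Cdiff_ext (fun w => f i w * c i + \sum_(j <- r) f j w * c j)%R).
  by move=> w; rewrite big_cons.
exact: Cdiff_lin.
Qed.

Section Separation.
Variables (T : finType) (K U : T -> Cx -> Prop) (F : (T -> Cx) -> CC).
Hypothesis hK : forall i, Ccompact (K i).
Hypothesis hKU : forall i z, K i z -> U i z.
Hypothesis hF : forall x i, (forall j, U j (x j)) -> forall w, U i w ->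
  Cdifferentiable_at (fun w => F (upd x i w)) w.
Variables (d B : R).
Hypothesis hd : 0 < d.
Hypothesis hB : forall x, (forall i, nbhd_of (K i) d (x i)) ->
  (forall i, U i (x i)) /\ nrm (F x) <= B.

Definition merge (s : seq T) (x y : T -> Cx) : T -> Cx :=
  fun i => if i \in s then x i else y i.

Lemma merge_upd s x y i w : i \notin s ->
  merge s x (upd y i w) = upd (merge s x y) i w.
Proof.
move=> ns; apply: funext => j; rewrite /merge /upd; case: (eqVneq j i) => [->|//].
by rewrite (negbTE ns).
Qed.

Lemma merge_cons s x y i : merge (i :: s) x y = merge s x (upd y i (x i)).
Proof.
apply: funext => j; rewrite /merge /upd inE; case: (eqVneq j i) => [->|//] /=.
by case: (i \in s).
Qed.

Lemma merge_in (V : T -> Cx -> Prop) s x y : (forall i, V i (x i)) -> (forall i, V i (y i)) ->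
  forall i, V i (merge s x y i).
Proof. by move=> hx hy i; rewrite /merge; case: ifP. Qed.

Definition term_val (s : seq T) (t : CC * (T -> Cx -> Cx)) (x : T -> Cx) : CC :=
  (t.1 * \prod_(i <- s) (t.2 i (x i) : CC))%R.

Definition separable_at (s : seq T) (y : T -> Cx) eps : Prop :=
  exists l : list (CC * (T -> Cx -> Cx)),
    (forall t, In t l -> forall i, holomorphic_on (U i) (t.2 i)) /\
    forall x, (forall i, K i (x i)) ->
      nrm (F (merge s x y) - \sum_(t <- l) term_val s t x)%R <= eps.

Lemma big_flat_map (A A' : Type) (f : A -> list A') (l : list A) (h : A' -> CC) :
  (\sum_(t <- flat_map f l) h t = \sum_(k <- l) \sum_(t <- f k) h t)%R.
Proof.
elim: l => [|k l IH]; first by rewrite !big_nil.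
by rewrite [flat_map _ _]/= big_cat big_cons IH.
Qed.

(** Variable [i] is the [l] of the cross approximation and the variables of [s] form its parameter.
    The factors in the parameter are [F] with variable [i] frozen at sample points of [K i], so the
    induction hypothesis applies to them. *)
Lemma separable_cons s i y eps : i \notin s -> (forall j, K j (y j)) -> 0 < eps ->
  (forall y' eps', (forall j, K j (y' j)) -> 0 < eps' -> separable_at s y' eps') ->
  separable_at (i :: s) y eps.
Proof.
move=> ns hy he IH.
have B0 : 0 <= B.
  have [|_ h] := hB (x := y); first by move=> j; apply: nbhd_of_self.
  exact: Rle_trans (nrm_ge0 _) h.
have he2 : 0 < eps / 2 by lra.
have [r [eta [e [eta0 heta hrank]]]] := uniform_rank_approx (hK (i := i)) hd B0 he2.
pose LT := {w : Cx | K i w}; pose XT := {x : T -> Cx | forall j, K j (x j)}.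
pose g0 (w : Cx) (x : T -> Cx) : CC := F (merge s x (upd y i w)).
have g0U x w : (forall j, K j (x j)) -> U i w -> Cdifferentiable_at (g0^~ x) w.
  move=> hx hw; apply: (@Cdiff_ext (fun w => F (upd (merge s x y) i w))).
    by move=> w'; rewrite /g0 merge_upd.
  by apply: hF => // j; apply: (merge_in (V := U)) => k; apply: hKU.
have g0in x w : (forall j, K j (x j)) -> nbhd_of (K i) d w ->
    forall j, nbhd_of (K j) d (merge s x (upd y i w) j).
  move=> hx hw; apply: (merge_in (V := fun j => nbhd_of (K j) d)) => j; first exact: nbhd_of_self.
  by rewrite /upd; case: eqP => [->//|_]; apply: nbhd_of_self.
have g0B x w : (forall j, K j (x j)) -> nbhd_of (K i) d w -> nrm (g0 w x) <= B.
  by move=> hx hw; have [] := hB (g0in x w hx hw).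
have nbU x w : (forall j, K j (x j)) -> nbhd_of (K i) d w -> U i w.
  move=> hx hw; have [h _] := hB (g0in x w hx hw); have := h i.
  by rewrite merge_upd // /upd eqxx.
pose g (l : LT) (x : XT) := g0 (sval l) (sval x).
have /choice [a ha] : forall x : XT, exists a : 'I_r -> CC, forall l : LT,
    nrm (g l x - \sum_k e k (sval l) * a k)%R <= eta.
  move=> [x hx]; have [z hz|a ha] := hrank (g0^~ x).
    by split; [apply: g0U => //; apply: nbU hz|apply: g0B].
  by exists a => -[l hl]; apply: ha.
have gB l x : nrm (g l x) <= B.
  by case: l x => [l hl] [x hx]; apply: g0B => //; apply: nbhd_of_self.
have [m [u [v [c hcross]]]] := @cross_approx LT XT g B gB r (fun k l => e k (sval l))
  (fun k x => a x k) eta eta0 (fun l x => ha x l).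
pose hk (k : 'I_m) (w : CC) : CC := (\sum_j g0 w (sval (v j)) * c j k)%R.
have hkU k : holomorphic_on (U i) (hk k).
  by move=> w hw; apply: Cdiff_sum => j; apply: g0U => //; apply: (svalP (v j)).
have [cM [cM0 hcM]] := fin_bound (fun p : 'I_m * 'I_m => nrm (c p.1 p.2)).
pose M := INR #|'I_m| * (B * cM).
have M0 : 0 <= M by apply: Rmult_le_pos; [apply: pos_INR|apply: Rmult_le_pos].
have hkM k w : K i w -> nrm (hk k w) <= M.
  move=> kw; apply: nrm_sum => j; rewrite nrmM.
  apply: Rmult_le_compat; [exact: nrm_ge0|exact: nrm_ge0| |exact: (hcM (j, k))].
  by apply: g0B; [apply: (svalP (v j))|apply: nbhd_of_self].
pose N := INR #|'I_m|; have N0 : 0 <= N by apply: pos_INR.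
have NM0 : 0 <= N * M by apply: Rmult_le_pos.
(* [M] bounds the functions [hk] and [N] counts them; both are fixed before the recursive
   approximations are requested, so their errors add up to at most [eps / 2]. *)
have he' : 0 < eps / (2 * (N * M + 1)) by apply: Rdiv_lt_0_compat; lra.
have /choice [lk hlk] := fun k : 'I_m => IH (upd y i (sval (u k))) _ (upd_in hy (svalP (u k))) he'.
(* Since [i \notin s], the slot [i] of each recursive term is free to receive [hk k]. *)
exists (flat_map (fun k => [seq (t.1, fun j => if j == i then hk k else t.2 j) | t <- lk k]) (enum 'I_m)).
split.
  move=> t /in_flat_map [k [_ /in_map_iff [t' [<- ht']]]] j /=.
  case: eqP => [->|_]; first exact: hkU.
  by have [h _] := hlk k; apply: h.
move=> x hx; rewrite merge_cons -/(g0 (x i) x).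
rewrite big_flat_map big_enum /=.
have hc := hcross (exist _ (x i) (hx i)) (exist _ x hx).
apply: Rle_trans (nrm_dist _ (\sum_j (\sum_k g0 (x i) (sval (v k)) * c k j) * g0 (sval (u j)) x)%R _) _.
have -> : eps = eps / 2 + eps / 2 by field.
apply: Rplus_le_compat; first exact: Rle_trans hc heta.
rewrite -sumrB.
apply: Rle_trans (_ : N * (M * (eps / (2 * (N * M + 1)))) <= _); last first.
  have -> : eps / 2 = (N * M + 1) * (eps / (2 * (N * M + 1))) by field; lra.
  by rewrite -Rmult_assoc; apply: Rmult_le_compat_r; lra.
apply: nrm_sum => k.
have -> : (\sum_(t <- [seq (t.1, fun j => if j == i then hk k else t.2 j) | t <- lk k]) term_val (i :: s) t x
  = hk k (x i) * \sum_(t <- lk k) term_val s t x)%R.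
  rewrite big_map mulr_sumr; apply: eq_bigr => t _.
  rewrite /term_val /= big_cons eqxx mulrCA; congr (_ * (_ * _))%R.
  apply: eq_big_seq => j hj; case: eqP => // ej.
  by move: ns; rewrite -ej hj.
rewrite -/(hk k (x i)) -mulrBr nrmM.
apply: Rmult_le_compat; [exact: nrm_ge0|exact: nrm_ge0|exact: hkM|].
by have [_ h] := hlk k; apply: h.
Qed.

Lemma separable s : uniq s -> forall y eps, (forall j, K j (y j)) -> 0 < eps -> separable_at s y eps.
Proof.
elim: s => [_|i s IH /= /andP [ns us]] y eps hy he.
  exists [:: (F y, fun _ _ => C0)]; split.
    by move=> t [<-|[]] i z _; apply: Cdiff_const.
  move=> x hx; rewrite big_seq1 /term_val big_nil mulr1 (_ : merge [::] x y = y) ?subrr ?nrm0; first by lra.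
  exact: funext.
by apply: separable_cons => // y' eps' hy' he'; apply: IH.
Qed.

End Separation.

(** * Polarization *)

Lemma natr_CC k : (k%:R : CC)%R = RtoC (INR k).
Proof.
elim: k => [//|k IH]; rewrite -addn1 natrD IH.
by rewrite addn1 S_INR; apply: injective_projections => /=; ring.
Qed.

Lemma nrm_natr k : nrm k%:R%R = INR k.
Proof. by rewrite natr_CC /nrm Cmod_R Rabs_pos_eq //; apply: pos_INR. Qed.

Lemma unit_circle_angle x y : x ^ 2 + y ^ 2 = 1 -> exists t, cos t = x /\ sin t = y.
Proof.
move=> h.
have hx : -1 <= x <= 1 by split; nra.
have hs : sqrt (1 - x²) = Rabs y.
  by rewrite (_ : 1 - x² = y²) ?sqrt_Rsqr_abs // /Rsqr; lra.
case: (Rle_lt_dec 0 y) => hy.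
  by exists (acos x); rewrite cos_acos // sin_acos // hs Rabs_pos_eq.
by exists (- acos x); rewrite cos_neg sin_neg cos_acos // sin_acos // hs Rabs_left //; split; ring.
Qed.

Lemma de_Moivre t n : (((cos t, sin t) : CC) ^+ n)%R = (cos (INR n * t), sin (INR n * t)).
Proof.
elim: n => [|n IH]; first by rewrite expr0 /= Rmult_0_l cos_0 sin_0.
rewrite exprSr IH S_INR Rmult_plus_distr_r Rmult_1_l cos_plus sin_plus.
by apply: injective_projections => /=; ring.
Qed.

(** Lets a coefficient be absorbed into a product over [n] variables: each of the [n] equal factors
    takes [w]. *)
Lemma Cnth_root (z : CC) n : (0 < n)%N -> exists w : CC, (w ^+ n)%R = z.
Proof.
move=> hn; have hN : 0 < INR n by apply: lt_0_INR; apply/ltP.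
case: (classic (z = 0%R)) => [->|nz]; first by exists 0%R; rewrite expr0n eqn0Ngt hn.
have hz : 0 < nrm z by apply/nrm_gt0.
set r := nrm z in hz.
have hr2 : r ^ 2 = fst z ^ 2 + snd z ^ 2.
  by rewrite /r /nrm /Cmod pow2_sqrt //; nra.
have [t [ht1 ht2]] : exists t, cos t = fst z / r /\ sin t = snd z / r.
  apply: unit_circle_angle.
  have -> : (fst z / r) ^ 2 + (snd z / r) ^ 2 = (fst z ^ 2 + snd z ^ 2) / r ^ 2 by field; lra.
  by rewrite -hr2; field; lra.
pose rho : CC := RtoC (Rpower r (/ INR n)).
have hrho k : (rho ^+ k)%R = RtoC (Rpower r (/ INR n) ^ k).
  elim: k => [|k IH]; first by rewrite expr0.
  by rewrite exprS IH; apply: injective_projections => /=; ring.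
exists (rho * ((cos (t / INR n), sin (t / INR n)) : CC))%R.
rewrite exprMn hrho de_Moivre -Rpower_pow; last by apply: exp_pos.
rewrite Rpower_mult Rinv_l ?Rpower_1 //; last by lra.
rewrite (_ : INR n * (t / INR n) = t); last by field; lra.
by rewrite ht1 ht2; apply: injective_projections => /=; field; lra.
Qed.

(* Inclusion-exclusion over the sets [S] containing the image of [f]. *)
Lemma signed_supersets n (f : {ffun 'I_n -> 'I_n}) :
  (\sum_(S : {set 'I_n}) (if f \in ffun_on (mem S) then (-1) ^+ #|~: S| else 0)
   = (injectiveb f)%:R :> CC)%R.
Proof.
(* The product of all [1 + G k] is 1 if [f] is onto, hence injective, and has a zero factor
   otherwise. Expanded over subsets, the term of [S] vanishes unless [S] contains the image of
   [f]. *)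
pose G (k : 'I_n) : CC := (if k \in codom f then 0 else -1)%R.
have -> : ((injectiveb f)%:R = \prod_k (1 + G k) :> CC)%R.
  case: (boolP (injectiveb f)) => [/injectiveP inj|ninj].
    rewrite big1 // => k _; rewrite /G.
    have [g fg gf] := injF_bij inj.
    by rewrite -(gf k) codom_f addr0.
  have [k hk] : exists k, k \notin codom f.
    apply: NNPP => h; case/negP: ninj; apply/injectiveP.
    have sur k : k \in codom f by apply: NNPP => nk; apply: h; exists k; apply/negP.
    have /leq_size_uniq : uniq (enum 'I_n) by apply: enum_uniq.
    move/(_ (codom f)) => H; apply/injectiveP; apply: H => //.
    by rewrite size_codom size_enum_ord card_ord.
  by rewrite (bigD1 k) //= /G (negbTE hk) subrr mul0r.
rewrite bigA_distr /=; apply: eq_bigr => S _.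
case: ifPn => [/ffun_onP hf|nf].
  rewrite (bigID (mem S)) /= big1 ?mul1r; last by move=> k ->.
  rewrite (eq_bigr (fun _ => -1)%R); last first.
    move=> k nk; rewrite (negbTE nk) /G; case: ifP => // /codomP [j ej].
    by move: nk; rewrite ej hf.
  rewrite prodr_const; congr (_ ^+ _)%R; apply: eq_card => k; by rewrite !inE.
have [j hj] : exists j, f j \notin S.
  by apply: NNPP => h; case/negP: nf; apply/ffun_onP => j; apply: NNPP => nj; apply: h; exists j; apply/negP.
by rewrite (bigD1 (f j)) //= (negbTE hj) /G codom_f mul0r.
Qed.

(** Ryser's formula for the permanent. For [m k j = a k (l j)], each term on the right is a signed
    product over [j] of the single function [\sum_(k in S) a k]. *)
Lemma permanent_polarization n (m : 'I_n -> 'I_n -> CC) :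
  (\sum_(s : {perm 'I_n}) \prod_j m (s j) j
   = \sum_(S : {set 'I_n}) (-1) ^+ #|~: S| * \prod_j \sum_(k in S) m k j)%R.
Proof.
transitivity (\sum_(f : {ffun 'I_n -> 'I_n}) (injectiveb f)%:R * \prod_j m (f j) j)%R; last first.
  transitivity (\sum_(f : {ffun 'I_n -> 'I_n}) \sum_(S : {set 'I_n})
     (if f \in ffun_on (mem S) then (-1) ^+ #|~: S| else 0) * \prod_j m (f j) j)%R.
    by apply: eq_bigr => f _; rewrite -signed_supersets mulr_suml.
  rewrite exchange_big; apply: eq_bigr => S _ /=.
  rewrite (bigA_distr_big (mem S) (fun j k => m k j)) /= mulr_sumr [RHS]big_mkcond.
  by apply: eq_bigr => f _; case: ifP => _; rewrite ?mul0r.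
rewrite [RHS](bigID (fun f : {ffun 'I_n -> 'I_n} => injectiveb f)) /=.
rewrite [X in _ = (_ + X)%R]big1 ?addr0; last first.
  by move=> f /negbTE ->; rewrite mul0r.
rewrite [RHS](reindex (@pval _)) /=; last first.
  pose in_Sn := insubd (1%g : {perm 'I_n}).
  by exists in_Sn => /= f Uf; first apply: val_inj; apply: insubdK.
apply: eq_big => [s|s _]; first by rewrite (valP s).
by rewrite (valP s) mul1r; apply: eq_bigr => j _; rewrite pvalE.
Qed.

(** * Averaging over permutations of both groups of variables *)

Definition pow_val n (t : (CC -> CC) * (CC -> CC)) (l z : 'I_n -> Cx) : CC :=
  (\prod_i (t.1 (l i) * t.2 (z i)))%R.

Definition power_approximable n (F : ('I_n -> Cx) -> ('I_n -> Cx) -> CC) (K P U W : Cx -> Prop) eps : Prop :=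
  exists L : list ((CC -> CC) * (CC -> CC)),
    (forall t, In t L -> holomorphic_on U t.1 /\ holomorphic_on W t.2) /\
    forall l z, (forall i, K (l i)) -> (forall i, P (z i)) ->
      nrm (F l z - \sum_(t <- L) pow_val t l z)%R <= eps.

Lemma perm_prod_inv n (s : {perm 'I_n}) (a : 'I_n -> CC -> CC) (l : 'I_n -> Cx) :
  (\prod_i a i (l ((s^-1)%g i)) = \prod_j a (s j) (l j))%R.
Proof.
by rewrite (reindex_inj (@perm_inj _ s)) /=; apply: eq_bigr => j _; rewrite permK.
Qed.

Section Symmetrization.
Variables (n : nat) (F : ('I_n -> Cx) -> ('I_n -> Cx) -> CC) (K P U W : Cx -> Prop).
Hypothesis hn : (0 < n)%N.
Hypothesis hsym : separately_symmetric F.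

Lemma sym_perm (s t : {perm 'I_n}) l z : F (fun i => l (s i)) (fun i => z (t i)) = F l z.
Proof.
have bij (p : {perm 'I_n}) : bijective p by exists (p^-1)%g; [apply: permK|apply: permKV].
have [_ ->] := hsym (bij t) (fun i => l (s i)) z.
by have [-> _] := hsym (bij s) l z.
Qed.

(** [F] equals its own average over all pairs of permutations, so averaging the approximation keeps
    the error. Each product averages to a multiple of a product of two permanents, to which
    [permanent_polarization] applies. *)
Lemma symmetrize (L : list (CC * ('I_n + 'I_n -> CC -> CC))) eps :
  (forall t, In t L -> forall i, (holomorphic_on U (t.2 (inl i))) /\ holomorphic_on W (t.2 (inr i))) ->
  (forall l z, (forall i, K (l i)) -> (forall i, P (z i)) ->
     nrm (F l z - \sum_(t <- L) t.1 * ((\prod_i t.2 (inl i) (l i)) * (\prod_i t.2 (inr i) (z i))))%R <= eps) ->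
  power_approximable F K P U W eps.
Proof.
move=> hL happ.
pose Q : finType := ({perm 'I_n} * {perm 'I_n})%type.
pose N := #|Q|.
have N0 : 0 < INR N.
  by apply: lt_0_INR; apply/ltP; apply/card_gt0P; exists (1%g, 1%g).
have nN : (N%:R : CC)%R <> 0%R by apply/nrm_gt0; rewrite nrm_natr.
pose A l z : CC := (\sum_(t <- L) t.1 * ((\prod_i t.2 (inl i) (l i)) * (\prod_i t.2 (inr i) (z i))))%R.
pose sg (S : {set 'I_n}) : CC := ((-1) ^+ #|~: S|)%R.
pose SS : finType := ({set 'I_n} * {set 'I_n})%type.
have /choice [rt hrt] := fun c : CC => Cnth_root c hn.
pose kap (t : CC * ('I_n + 'I_n -> CC -> CC)) (p : SS) : CC := (N%:R^-1 * (t.1 * (sg p.1 * sg p.2)))%R.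
(* The whole coefficient goes into [phi] as an [n]-th root. The factor 1 in [psi] gives it the shape
   required by [Cdiff_sum]. *)
pose phi t (p : SS) (w : CC) : CC := (\sum_(k <- enum p.1) t.2 (inl k) w * rt (kap t p))%R.
pose psi (t : CC * ('I_n + 'I_n -> CC -> CC)) (p : SS) (w : CC) : CC := (\sum_(k <- enum p.2) t.2 (inr k) w * 1)%R.
exists (flat_map (fun t => [seq (phi t p, psi t p) | p <- enum SS]) L); split.
  move=> _ /in_flat_map [t [ht /in_map_iff [p [<- _]]]] /=.
  split=> w hw; apply: Cdiff_sum => k.
    by have [h _] := hL t ht k; apply: h.
  by have [_ h] := hL t ht k; apply: h.
move=> l z hl hz.
have -> : (\sum_(t <- flat_map (fun t => [seq (phi t p, psi t p) | p <- enum SS]) L) pow_val t l z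
   = N%:R^-1 * \sum_(q : Q) A (fun i => l ((q.1^-1)%g i)) (fun i => z ((q.2^-1)%g i)))%R.
  rewrite big_flat_map /A exchange_big mulr_sumr; apply: eq_bigr => t _ /=.
  rewrite big_map big_enum /=.
  transitivity (\sum_(p : SS) kap t p * ((\prod_j \sum_(k in p.1) t.2 (inl k) (l j)) *
     (\prod_j \sum_(k in p.2) t.2 (inr k) (z j))))%R.
    apply: eq_bigr => p _; rewrite /pow_val /= big_split /=.
    have -> : (kap t p = \prod_(j < n) rt (kap t p))%R by rewrite prodr_const card_ord hrt.
    rewrite mulrA -[X in _ = (X * _)%R]big_split /=.
    congr (_ * _)%R; apply: eq_bigr => j _.
      by rewrite /phi -mulr_suml big_enum mulrC.
    by rewrite /psi big_enum; apply: eq_bigr => k _; rewrite mulr1.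
  rewrite -[X in _ = (_ * X)%R]mulr_sumr.
  rewrite -(pair_bigA _ (fun s u : {perm 'I_n} => (\prod_i t.2 (inl i) (l ((s^-1)%g i))) *
     (\prod_i t.2 (inr i) (z ((u^-1)%g i)))))%R /=.
  rewrite -big_distrlr /=.
  rewrite (eq_bigr _ (fun s _ => perm_prod_inv s (fun i => t.2 (inl i)) l)).
  rewrite (eq_bigr _ (fun s _ => perm_prod_inv s (fun i => t.2 (inr i)) z)).
  rewrite (permanent_polarization (fun k j => t.2 (inl k) (l j))).
  rewrite (permanent_polarization (fun k j => t.2 (inr k) (z j))).
  rewrite big_distrlr pair_bigA !mulr_sumr /=; apply: eq_bigr => p _.
  by rewrite /kap -!mulrA; congr (_ * (_ * (_ * _)))%R; rewrite mulrCA.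
have -> : F l z = (N%:R^-1 * \sum_(q : Q) F (fun i => l ((q.1^-1)%g i)) (fun i => z ((q.2^-1)%g i)))%R.
  rewrite (eq_bigr (fun _ => F l z)); last by move=> q _; rewrite sym_perm.
  by rewrite sumr_const -[(F l z *+ _)%R]mulr_natl mulrA mulVf ?mul1r //; apply/eqP.
rewrite -mulrBr -sumrB nrmM nrmV // nrm_natr.
apply: (Rmult_le_reg_l (INR N)) => //.
rewrite -Rmult_assoc Rinv_r ?Rmult_1_l; last by lra.
by apply: nrm_sum => q; apply: happ.
Qed.

End Symmetrization.

(** * Assembling the series *)

Section Series.
Variables (Tm X : Type) (ev : Tm -> X -> CC) (F : X -> CC) (t0 : Tm).
Hypothesis ev_scale : forall (c : CC) t, exists t', forall x, ev t' x = (c * ev t x)%R.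
Hypothesis ev_bounded : forall t, exists M, forall x, nrm (ev t x) <= M.
Hypothesis ev_t0 : forall x, ev t0 x = 0%R.
Hypothesis happ : forall eps, 0 < eps -> exists L : seq Tm, forall x,
  nrm (F x - \sum_(t <- L) ev t x)%R <= eps.

Definition lsum (L : seq Tm) x : CC := (\sum_(t <- L) ev t x)%R.

Lemma lsum_cat L L' x : lsum (L ++ L') x = (lsum L x + lsum L' x)%R.
Proof. exact: big_cat. Qed.

(** Stated for all prefixes because [tame_list] controls partial sums as well as totals. *)
Lemma scale_list c L : exists L', forall j x, lsum (take j L') x = (c * lsum (take j L) x)%R.
Proof.
elim: L => [|t L [L' IH]]; first by exists [::] => j x; rewrite /lsum !big_nil mulr0.
have [t' ht'] := ev_scale c t.
exists (t' :: L') => -[|j] x; first by rewrite /= /lsum !big_nil mulr0.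
by rewrite /= /lsum !big_cons mulrDr ht'; congr (_ + _)%R; apply: IH.
Qed.

Lemma prefix_sums_bounded L : exists C, 0 <= C /\ forall j x, nrm (lsum (take j L) x) <= C.
Proof.
elim: L => [|t L [C [C0 IH]]].
  by exists 0; split; [lra|move=> j x; rewrite /lsum big_nil nrm0; lra].
have [M hM] := ev_bounded t.
exists (Rmax 0 M + C); split; first by have := Rmax_l 0 M; lra.
move=> [|j] x /=; first by rewrite /lsum big_nil nrm0; have := Rmax_l 0 M; lra.
rewrite /lsum big_cons; apply: Rle_trans (nrmD _ _) _.
apply: Rplus_le_compat; last exact: IH.
exact: Rle_trans (hM x) (Rmax_r _ _).
Qed.

(* Running through [m] copies of the list, each scaled by [1/m], keeps every partial
   sum close to a fraction of the total. *)
Lemma tame_list L beta eta : 0 <= beta -> 0 < eta -> (forall x, nrm (lsum L x) <= beta) ->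
  exists L', (forall x, lsum L' x = lsum L x) /\
    forall j x, nrm (lsum (take j L') x) <= beta + eta.
Proof.
move=> b0 he hL.
have [C [C0 hC]] := prefix_sums_bounded L.
(* [C / eta < m] makes each scaled prefix at most [eta]; the maximum with 0 forces [m] to be
   positive. *)
have [m hm] := INR_unbounded (Rmax 0 (C / eta)).
have m0 : 0 < INR m by have := Rmax_l 0 (C / eta); lra.
have nm : (m%:R : CC)%R <> 0%R by apply/nrm_gt0; rewrite nrm_natr.
have [L0 hL0] := scale_list (m%:R^-1)%R L.
have im : 0 < / INR m by apply: Rinv_0_lt_compat.
have pre j x : nrm (lsum (take j L0) x) <= eta.
  rewrite hL0 nrmM nrmV // nrm_natr.
  apply: (Rmult_le_reg_l (INR m)) => //.
  rewrite -Rmult_assoc Rinv_r ?Rmult_1_l; last by lra.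
  apply: Rle_trans (hC j x) _.
  have h : C / eta < INR m by have := Rmax_r 0 (C / eta); lra.
  have -> : C = C / eta * eta by field; lra.
  by apply: Rmult_le_compat_r; lra.
have tot x : lsum L0 x = (m%:R^-1 * lsum L x)%R.
  have := hL0 (maxn (size L0) (size L)) x.
  by rewrite !take_oversize ?leq_maxl ?leq_maxr.
have totk k x : lsum (flatten (nseq k L0)) x = (k%:R * (m%:R^-1 * lsum L x))%R.
  elim: k => [|k IH]; first by rewrite /lsum big_nil mul0r.
  by rewrite /= lsum_cat IH tot -addn1 natrD mulrDl mul1r addrC.
exists (flatten (nseq m L0)); split.
  by move=> x; rewrite totk mulrA mulfV ?mul1r //; apply/eqP.
(* A prefix consists of whole copies, contributing at most [beta / m] each, and one truncated copy,
   contributing at most [eta]. *)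
have H k j x : nrm (lsum (take j (flatten (nseq k L0))) x) <= INR k * (/ INR m * beta) + eta.
  elim: k j => [|k IH] j; first by rewrite /= /lsum big_nil nrm0; lra.
  rewrite [flatten _]/= take_cat; case: ifP => _.
    apply: Rle_trans (pre j x) _.
    have : 0 <= INR k.+1 * (/ INR m * beta).
      by apply: Rmult_le_pos; [apply: pos_INR|apply: Rmult_le_pos; lra].
    by lra.
  rewrite lsum_cat S_INR; apply: Rle_trans (nrmD _ _) _.
  have -> : (INR k + 1) * (/ INR m * beta) + eta = / INR m * beta + (INR k * (/ INR m * beta) + eta) by ring.
  apply: Rplus_le_compat (IH _).
  rewrite tot nrmM nrmV // nrm_natr.
  by apply: Rmult_le_compat_l; [lra|apply: hL].
move=> j x; apply: Rle_trans (H m j x) _; apply: Req_le; field; lra.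
Qed.

(** The block [B] sums to an approximation of precision [e2] minus [A], a difference of norm at most
    [e1 + e2]. Taming adds another [e2] for its prefixes, and the distance from [A] to [F] accounts
    for the remaining [e1]. *)
Lemma extend_list A e1 e2 : 0 < e1 -> 0 < e2 -> (forall x, nrm (F x - lsum A x)%R <= e1) ->
  exists B, [/\ (0 < size B)%N, forall x, nrm (F x - lsum (A ++ B) x)%R <= e2 &
    forall j x, nrm (F x - lsum (A ++ take j B) x)%R <= 2 * e1 + 2 * e2].
Proof.
move=> h1 h2 hA; have [L hL] := happ h2.
have [A' hA'] := scale_list (-1)%R A.
have tA' x : lsum A' x = (- lsum A x)%R.
  have := hA' (maxn (size A') (size A)) x.
  by rewrite !take_oversize ?leq_maxl ?leq_maxr // mulN1r.
have [||x|B [hB1 hB2]] := @tame_list (L ++ A') (e1 + e2) e2; [lra|lra| |].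
  rewrite lsum_cat tA' -(nrmN (_ - _)%R) opprB.
  rewrite (_ : (lsum A x - lsum L x = (F x - lsum L x) - (F x - lsum A x))%R); last first.
    by rewrite opprB [RHS]addrC [RHS]addrA subrK.
  apply: Rle_trans (nrmB _ _) _; rewrite Rplus_comm.
  by apply: Rplus_le_compat; [apply: hA|apply: hL].
(* The null term makes the block nonempty, so that the concatenated blocks reach every index of the
   series. *)
exists (t0 :: B); split => // [x|j x].
  rewrite lsum_cat {2}/lsum big_cons ev_t0 add0r -/(lsum B x) hB1 lsum_cat tA'.
  by rewrite [(lsum A x + _)%R]addrC subrK; apply: hL.
rewrite lsum_cat.
have -> : 2 * e1 + 2 * e2 = e1 + (e1 + e2 + e2) by ring.
rewrite opprD addrA; apply: Rle_trans (nrmB _ _) _; apply: Rplus_le_compat => //.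
case: j => [|j]; first by rewrite /= /lsum big_nil nrm0; lra.
by rewrite /= {1}/lsum big_cons ev_t0 add0r; apply: hB2.
Qed.

(** The lists [A k] extend one another, so their entries define one sequence. A partial sum ending
    in the block after [A k] is within [4 * (/ 2) ^ k] of [F], by the bound on prefixes in
    [extend_list]. *)
Lemma series_of_approximations : exists s : nat -> Tm, forall eps, 0 < eps ->
  exists N, forall M, (N <= M)%N -> forall x, nrm (F x - \sum_(p < M) ev (s p) x)%R < eps.
Proof.
have [A0 hA0] := happ Rlt_0_1.
have /choice [nx hnx] : forall p : nat * seq Tm, exists B,
    (forall x, nrm (F x - lsum p.2 x)%R <= (/ 2) ^ p.1) ->
    [/\ (0 < size B)%N, forall x, nrm (F x - lsum (p.2 ++ B) x)%R <= (/ 2) ^ p.1.+1 &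
      forall j x, nrm (F x - lsum (p.2 ++ take j B) x)%R <= 4 * (/ 2) ^ p.1].
  move=> [k A] /=.
  case: (classic (forall x, nrm (F x - lsum A x)%R <= (/ 2) ^ k)) => h; last by exists [::].
  have [B [b1 b2 b3]] := extend_list (half_pow_pos k) (half_pow_pos k.+1) h.
  exists B => _; split => // j x; apply: Rle_trans (b3 j x) _.
  by have := half_pow_pos k; rewrite /=; lra.
pose A k := nat_rect (fun _ => seq Tm) A0 (fun k A => A ++ nx (k, A)) k.
have AS k : A k.+1 = A k ++ nx (k, A k) by [].
have hA k : forall x, nrm (F x - lsum (A k) x)%R <= (/ 2) ^ k.
  elim: k => [|k IH]; first exact: hA0.
  by have [_ h _] := hnx (k, A k) IH; rewrite AS.
have szS k : (size (A k) < size (A k.+1))%N.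
  have [h _ _] := hnx (k, A k) (hA k).
  by rewrite AS size_cat -[X in (X < _)%N]addn0 ltn_add2l.
have sz k : (k <= size (A k))%N.
  by elim: k => [//|k IH]; apply: leq_ltn_trans IH (szS k).
have nthA k d p : (p < size (A k))%N -> nth t0 (A (k + d)%N) p = nth t0 (A k) p /\ (p < size (A (k + d)))%N.
  move=> hp; elim: d => [|d [IH1 IH2]]; first by rewrite addn0.
  rewrite addnS; split; last exact: ltn_trans IH2 (szS _).
  by rewrite AS nth_cat IH2.
(* [A p.+1] has at least [p.+1] entries by [sz], so the default [t0] is never read. *)
pose s p := nth t0 (A p.+1) p.
have sA k p : (p < size (A k))%N -> s p = nth t0 (A k) p.
  move=> hp; rewrite /s; case: (leqP k p.+1) => h.
    by have [e _] := nthA k (p.+1 - k)%N p hp; rewrite subnKC in e.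
  by have [e _] := nthA p.+1 (k - p.+1)%N p (sz p.+1); rewrite subnKC ?(ltnW h) // in e.
have sumA k M x : (M <= size (A k))%N -> (\sum_(p < M) ev (s p) x = lsum (take M (A k)) x)%R.
  move=> hM; rewrite /lsum (big_nth t0) size_takel // big_mkord; apply: eq_bigr => p _.
  by rewrite nth_take // -sA //; apply: leq_trans (ltn_ord p) hM.
exists s => eps he.
have he4 : 0 < eps / 4 by lra.
have [k hk] := half_pow_lt he4.
exists (size (A k)) => M hM x.
apply: Rle_lt_trans (_ : 4 * (/ 2) ^ k < eps); last by lra.
(* Induction on [d] locates the block in which [M] falls. *)
have H d : (M <= size (A (k + d)))%N -> nrm (F x - \sum_(p < M) ev (s p) x)%R <= 4 * (/ 2) ^ k.
  elim: d => [|d IH].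
    rewrite addn0 => hM2; rewrite (sumA k) // take_oversize //.
    by have := hA k x; have := half_pow_pos k; lra.
  case: (leqP M (size (A (k + d)%N))) => [/IH //|h1].
  rewrite addnS => h2; rewrite (sumA (k + d)%N.+1) // AS take_cat ltnNge (ltnW h1) /=.
  have [_ _ h3] := hnx ((k + d)%N, A (k + d)%N) (hA _).
  apply: Rle_trans (h3 _ x) _ => /=; apply: Rmult_le_compat_l; first by lra.
  rewrite pow_add -[X in _ <= X]Rmult_1_r; apply: Rmult_le_compat_l.
    exact: Rlt_le (half_pow_pos k).
  rewrite -(pow1 d); apply: pow_incr; lra.
by apply: (H M); apply: leq_trans (sz _); apply: leq_addl.
Qed.

End Series.

(** * Joint holomorphy and conclusion *)

Lemma RplusA : associative Rplus. Proof. by move=> x y z; ring. Qed.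
Lemma RplusC : commutative Rplus. Proof. by move=> x y; ring. Qed.
Lemma Rplus0 : left_id 0 Rplus. Proof. by move=> x; ring. Qed.

HB.instance Definition _ := Monoid.isComLaw.Build R 0 Rplus RplusA RplusC Rplus0.

Lemma Rsum_le n (f : 'I_n -> R) M : (forall i, f i <= M) -> Rsum f <= INR n * M.
Proof.
move=> hf; rewrite /Rsum; elim: n f hf => [|n IH] f hf; first by rewrite big_ord0 /=; lra.
rewrite big_ord_recr S_INR Rmult_plus_distr_r Rmult_1_l.
by apply: Rplus_le_compat => //; apply: IH.
Qed.

Lemma Rsum_single n (f : 'I_n -> R) k : (forall i, i != k -> f i = 0) -> Rsum f = f k.
Proof.
move=> hf; rewrite /Rsum (bigD1 k) //=.
by rewrite big1 ?Rplus_0_r.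
Qed.

Lemma Csum_single n (f : 'I_n -> Cx) k : (forall i, i != k -> f i = C0) -> Csum f = f k.
Proof.
move=> hf; change ((\sum_(i < n) (f i : CC))%R = f k :> CC).
by rewrite (bigD1 k) //= big1 ?addr0.
Qed.

Lemma Csum0 n (f : 'I_n -> Cx) : (forall i, f i = C0) -> Csum f = C0.
Proof. by move=> hf; change ((\sum_(i < n) (f i : CC))%R = 0%R :> CC); rewrite big1. Qed.

Lemma nrm_Csum n (f : 'I_n -> Cx) M : (forall i, Cmod (f i) <= M) -> Cmod (Csum f) <= INR n * M.
Proof. by move=> hf; rewrite -{2}(card_ord n); apply: (nrm_sum (f := f : 'I_n -> CC)). Qed.

Lemma holomorphic_bounded (K U : Cx -> Prop) (f : CC -> CC) : Ccompact K ->
  (forall z, K z -> U z) -> holomorphic_on U f -> exists M, forall z, K z -> nrm (f z) <= M.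
Proof.
move=> hK hKU hf.
have /choice [r hr] : forall c, exists d, K c -> 0 < d /\
    forall w, Cmod (w - c) < d -> Cmod (f w - f c) < 1.
  move=> c; case: (classic (K c)) => kc; last by exists 0.
  by have [d h] := Cdiff_cont (hf c (hKU c kc)) Rlt_0_1; exists d.
have [|l hl] := compact_balls (r := r) hK; first by move=> c /hr [].
have [M hM] := list_max l (fun c => Cmod (f c) + 1).
exists M => z /hl [c [ic kc hc]]; apply: Rle_trans (hM c ic).
have [_ h] := hr c kc; have := h z hc; have := Cmod_sub_ge (f z) (f c).
by rewrite /nrm; lra.
Qed.

(** Both groups of variables become one family over ['I_n + 'I_n], so that separation treats them
    alike. *)
Definition sumfam (A : Type) n (V W : A) (i : 'I_n + 'I_n) : A :=
  match i with inl _ => V | inr _ => W end.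

Definition join n (l z : 'I_n -> Cx) (i : 'I_n + 'I_n) : Cx :=
  match i with inl k => l k | inr k => z k end.

Definition uncurried n (F : ('I_n -> Cx) -> ('I_n -> Cx) -> Cx) (x : 'I_n + 'I_n -> Cx) : CC :=
  F (fun i => x (inl i)) (fun i => x (inr i)).

Lemma Csub_self (z : Cx) : Csub z z = C0.
Proof. by change ((z - z)%C = 0%C); ring. Qed.

Section Joint.
Variables (n : nat) (U W : Cx -> Prop) (F : ('I_n -> Cx) -> ('I_n -> Cx) -> Cx).
Hypothesis hn : (0 < n)%N.
Hypothesis hU : Copen U.
Hypothesis hW : Copen W.
Hypothesis hF : holomorphic_on_prod U W F.

(** Moving one coordinate makes every other increment vanish, so the sums in the joint condition
    collapse to one term. *)
Lemma slice_diff x i : (forall j, sumfam U W j (x j)) -> forall w, sumfam U W i w ->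
  Cdifferentiable_at (fun w => uncurried F (upd x i w)) w.
Proof.
move=> hx w hw; pose p := upd x i w.
have hp : forall j, sumfam U W j (p j) by apply: upd_in.
have [a [b hab]] := hF (fun k => hp (inl k)) (fun k => hp (inr k)).
exists (match i with inl k => a k | inr k => b k end) => eps heps.
have [d [hd h]] := hab eps heps; exists d; split => // w' hw'.
have hdist j : Cmod (upd x i w' j - p j) < d.
  rewrite /p /upd; case: eqP => // _.
  by rewrite (_ : (x j - x j)%C = 0%C) ?Cmod_0 //; ring.
have off j : j != i -> Csub (upd x i w' j) (p j) = C0.
  by move=> nj; rewrite /p /upd (negbTE nj); apply: Csub_self.
have on : Csub (upd x i w' i) (p i) = Csub w' w by rewrite /p /upd eqxx.
have mul0 (c : Cx) : Cmul c C0 = C0 by apply: (@mulr0 CC).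
have add0 (c : Cx) : Cadd c C0 = c by apply: (@addr0 CC).
have add0l (c : Cx) : Cadd C0 c = c by apply: (@add0r CC).
have {h} := h (fun k => upd x i w' (inl k)) (fun k => upd x i w' (inr k))
  (fun k => conj (hdist (inl k)) (hdist (inr k))).
rewrite -/(uncurried F (upd x i w')) -/(uncurried F p).
have n0 : Cnorm C0 = 0 by apply: Cmod_0.
have ep : upd x i w = p by [].
case: i hw p hp hab hdist off on ep => k hw p hp hab hdist off on ep.
- rewrite (@Csum_single _ _ k); last by move=> j nj; rewrite off.
  rewrite (@Csum0 _ (fun i => Cmul (b i) _)); last by move=> j; rewrite off.
  rewrite (@Rsum_single _ _ k); last by move=> j nj; rewrite !off // n0; lra.
  by rewrite ep on off // n0 Rplus_0_r add0.
- rewrite (@Csum_single _ (fun i => Cmul (b i) _) k); last by move=> j nj; rewrite off.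
  rewrite (@Csum0 _ (fun i => Cmul (a i) _)); last by move=> j; rewrite off.
  rewrite (@Rsum_single _ _ k); last by move=> j nj; rewrite !off // n0; lra.
  by rewrite ep on off // n0 Rplus_0_l add0l.
Qed.

(** The first-order expansion with error constant 1 bounds [F] on a small polydisc by its value at
    the center plus terms linear in the radius. *)
Lemma locally_bounded x : (forall j, sumfam U W j (x j)) ->
  exists d B, 0 < d /\ forall x', (forall i, Cmod (x' i - x i) < d) ->
    (forall i, sumfam U W i (x' i)) /\ nrm (uncurried F x') <= B.
Proof.
move=> hx.
have /choice [r hr] : forall i, exists r, 0 < r /\ forall w, Cmod (w - x i) < r -> sumfam U W i w.
  by case=> k; [apply: (hU (hx (inl k)))|apply: (hW (hx (inr k)))].
(* The least radius, as the maximum of [- r]; [hn] supplies the index that [fin_argmax] starts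
   from. *)
have [i0 hi0] := fin_argmax (fun i => - r i) (inl (Ordinal hn) : 'I_n + 'I_n).
have [a [b hab]] := hF (fun k => hx (inl k)) (fun k => hx (inr k)).
have [d [hd h]] := hab 1 Rlt_0_1.
have [ra ha] := fin_bound (fun i => Cmod (a i)).
have [rb hb] := fin_bound (fun i => Cmod (b i)).
exists (Rmin d (r i0)), (Cmod (uncurried F x) + (INR n * (ra * d) + INR n * (rb * d)) + 1 * (INR n * (d + d))).
split; first by apply: Rmin_pos => //; case: (hr i0).
move=> x' hx'.
have h1 i : Cmod (x' i - x i) < d by apply: Rlt_le_trans (hx' i) (Rmin_l _ _).
split.
  move=> i; have [_ H] := hr i; apply: H.
  by have := hi0 i; have := Rlt_le_trans _ _ _ (hx' i) (Rmin_r _ _); lra.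
have {}h := h (fun k => x' (inl k)) (fun k => x' (inr k)) (fun k => conj (h1 (inl k)) (h1 (inr k))).
set sa := Csum _ in h; set sb := Csum _ in h; set rs := Rsum _ in h.
have {}h : Cmod ((uncurried F x' - uncurried F x) - (sa + sb)) <= 1 * rs := h.
have hsa : Cmod sa <= INR n * (ra * d).
  apply: nrm_Csum => i; rewrite [Cmod _]Cmod_mult; case: ha => ra0 ha.
  by apply: Rmult_le_compat => //; [apply: Cmod_ge_0|apply: Cmod_ge_0|apply: Rlt_le; apply: (h1 (inl i))].
have hsb : Cmod sb <= INR n * (rb * d).
  apply: nrm_Csum => i; rewrite [Cmod _]Cmod_mult; case: hb => rb0 hb.
  by apply: Rmult_le_compat => //; [apply: Cmod_ge_0|apply: Cmod_ge_0|apply: Rlt_le; apply: (h1 (inr i))].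
have hrs : rs <= INR n * (d + d).
  by apply: Rsum_le => i; apply: Rplus_le_compat; apply: Rlt_le; [apply: (h1 (inl i))|apply: (h1 (inr i))].
have t1 := Cmod_sub_ge (uncurried F x' - uncurried F x) (sa + sb).
have t2 := Cmod_triangle sa sb.
have t3 := Cmod_sub_ge (uncurried F x') (uncurried F x).
by rewrite /nrm; lra.
Qed.

Variables (K P : Cx -> Prop).
Hypothesis hK : Ccompact K.
Hypothesis hP : Ccompact P.
Hypothesis hKU : forall z, K z -> U z.
Hypothesis hPW : forall z, P z -> W z.
Hypothesis hsym : separately_symmetric F.

Lemma power_approx eps : 0 < eps -> power_approximable (F : _ -> _ -> CC) K P U W eps.
Proof.
move=> he.
(* Separation takes a base point at which variables are frozen; if there is none, the claim is
   vacuous. *)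
case: (classic (exists l z : 'I_n -> Cx, (forall i, K (l i)) /\ (forall i, P (z i)))); last first.
  by move=> nlz; exists [::]; split => // l z hl hz; case: nlz; exists l, z.
move=> [l0 [z0 [hl0 hz0]]].
have hy : forall j, sumfam K P j (join l0 z0 j) by case.
have cK : forall i : 'I_n + 'I_n, Ccompact (sumfam K P i) by case.
have KU : forall (i : 'I_n + 'I_n) z, sumfam K P i z -> sumfam U W i z by case.
have [||d [B [hd hB]]] := @local_to_uniform _ (sumfam K P) cK
  (fun B x => (forall i, sumfam U W i (x i)) /\ nrm (uncurried F x) <= B).
- by move=> B B' x hBB [h1 h2]; split => //; lra.
- by move=> x hx; apply: locally_bounded => j; apply: KU.
have [L [hL1 hL2]] := separable cK KU slice_diff hd hB (enum_uniq {: 'I_n + 'I_n}) hy he.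
apply: (symmetrize hn hsym (L := L)).
  by move=> t ht i; split; [apply: (hL1 t ht (inl i))|apply: (hL1 t ht (inr i))].
move=> l z hl hz.
have hx : forall j, sumfam K P j (join l z j) by case.
have := hL2 (join l z) hx.
have -> : merge (enum {: 'I_n + 'I_n}) (join l z) (join l0 z0) = join l z.
  by apply: funext => j; rewrite /merge mem_enum.
rewrite (eq_bigr (fun t => t.1 * ((\prod_i t.2 (inl i) (l i)) * (\prod_i t.2 (inr i) (z i))) : CC)%R) //.
by move=> t _; rewrite /term_val big_enum big_sumType.
Qed.

End Joint.

Theorem theoremC1 (q : R) (hq : 0 < q) (n : nat) (hn : (0 < n)%N)
  (U W : Cx -> Prop) (hU : open_nbhd_segment q U) (hW : open_nbhd_segment q W)
  (F : ('I_n -> Cx) -> ('I_n -> Cx) -> Cx)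
  (hF : holomorphic_on_prod U W F) (hsym : separately_symmetric F)
  (K P : Cx -> Prop) (hK : Ccompact K) (hKU : forall z, K z -> U z)
  (hP : Ccompact P) (hPW : forall z, P z -> W z) :
  exists (VK VP : Cx -> Prop) (phi psi : nat -> Cx -> Cx),
    Copen VK /\ (forall z, K z -> VK z) /\
    Copen VP /\ (forall z, P z -> VP z) /\
    (forall p, holomorphic_on VK (phi p)) /\
    (forall p, holomorphic_on VP (psi p)) /\
    forall eps, 0 < eps -> exists N : nat, forall M : nat, (N <= M)%N ->
      forall l z : 'I_n -> Cx, (forall i, K (l i)) -> (forall i, P (z i)) ->
        Cnorm (Csub (F l z) (partial_sum phi psi M l z)) < eps.
Proof.
have [oU _] := hU; have [oW _] := hW.
(* Terms carry their proof of holomorphy and points their membership, so the abstract result on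
   series applies without side conditions. *)
pose Tm := {t : (CC -> CC) * (CC -> CC) | holomorphic_on U t.1 /\ holomorphic_on W t.2}.
pose X := {x : ('I_n -> Cx) * ('I_n -> Cx) | (forall i, K (x.1 i)) /\ (forall i, P (x.2 i))}.
pose ev (t : Tm) (x : X) : CC := pow_val (sval t) (sval x).1 (sval x).2.
pose F' (x : X) : CC := F (sval x).1 (sval x).2.
pose zero : CC -> CC := fun _ => 0%R.
have h0 : holomorphic_on U (zero, zero).1 /\ holomorphic_on W (zero, zero).2.
  by split => z _; apply: Cdiff_const.
pose t0 : Tm := exist _ (zero, zero) h0.
have [||||s hs] := @series_of_approximations Tm X ev F' t0.
- move=> c [[f g] [hf hg]]; have [w hw] := Cnth_root c hn.
  (* The scalar enters as its root [w], once per variable; the summand 0 gives the shape of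
     [Cdiff_lin]. *)
  have hf' : holomorphic_on U (fun v => f v * w + 0)%R.
    by move=> z hz; apply: (@Cdiff_lin _ (fun _ => 0%R)); [apply: hf|apply: Cdiff_const].
  exists (exist _ ((fun v => f v * w + 0)%R, g) (conj hf' hg)) => x.
  rewrite /ev /pow_val /= -hw -[X in (_ ^+ X)%R](card_ord n) -prodr_const -big_split /=.
  by apply: eq_bigr => i _; rewrite addr0 mulrAC mulrC.
- move=> [[f g] [hf hg]].
  have [Mf hMf] := holomorphic_bounded hK hKU hf.
  have [Mg hMg] := holomorphic_bounded hP hPW hg.
  exists ((Rmax 0 Mf * Rmax 0 Mg) ^ #|'I_n|) => -[[l z] [hl hz]].
  have m1 := Rmax_l 0 Mf; have m2 := Rmax_l 0 Mg.
  apply: nrm_prod => [|i /=]; first exact: Rmult_le_pos.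
  rewrite nrmM; apply: Rmult_le_compat; try exact: nrm_ge0.
    exact: Rle_trans (hMf _ (hl i)) (Rmax_r _ _).
  exact: Rle_trans (hMg _ (hz i)) (Rmax_r _ _).
- by move=> x; rewrite /ev /pow_val (bigD1 (Ordinal hn)) //= mul0r mul0r.
- move=> eps he.
  have [L [hL1 hL2]] := power_approx hn oU oW hF hK hP hKU hPW hsym he.
  have [L' eL'] : exists L' : seq Tm, [seq sval t | t <- L'] = L.
    elim: (L) hL1 => [|t L1 IH] h; first by exists [::].
    have [|L' <-] := IH; first by move=> t' ht'; apply: h; right.
    by exists (exist _ t (h t (or_introl erefl)) :: L').
  exists L' => -[[l z] [hl hz]]; have := hL2 l z hl hz.
  by rewrite -eL' big_map.
(* [U] and [W] themselves serve as the neighborhoods, since every factor is holomorphic there. *)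
exists U, W, (fun p => (sval (s p)).1), (fun p => (sval (s p)).2).
split => //; split => //; split => //; split => //; split; last split.
- by move=> p; have [] := svalP (s p).
- by move=> p; have [] := svalP (s p).
move=> eps he; have [N hN] := hs eps he; exists N => M hM l z hl hz.
exact: (hN M hM (exist _ (l, z) (conj hl hz))).
Qed.
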